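(* Let $W$ be any real-valued random variable with finite variance which is not almost surely constant, and put $\mu := \mathbb{E} W$, $\sigma^2 := \operatorname{Var}(W)$ (so $0<\sigma<\infty$). Then there exists a sequence $X_1, X_2, \ldots$ of triplewise independent random variables, each following the same distribution as $W$, such that the standardized partial sums \[ S_n := \frac{1}{\sigma\sqrt{n}}\Bigl(\sum_{k=1}^n X_k - n\mu\Bigr) \] converge in law, as $n\to\infty$, to a probability distribution which is not normal.
   Context: For an integer $K\ge 2$, an indexed family of random variables $X_i$, $i\in I$, is called $K$-tuplewise independent if $X_{i_1},\ldots,X_{i_K}$ are mutually independent for every choice of $K$ distinct indices $i_1,\ldots,i_K$. Triplewise independent means $3$-tuplewise independent. *)

(* Defs.v *)
From HB Require Import structures.
From mathcomp Require Import all_boot all_order all_algebra.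
From mathcomp Require Import all_classical all_reals all_analysis.
Set Implicit Arguments. Unset Strict Implicit. Unset Printing Implicit Defensive.
Import Order.TTheory GRing.Theory Num.Theory.
Import numFieldNormedType.Exports.
Local Open Scope classical_set_scope.
Local Open Scope ring_scope.

Definition mutually_independent {d} {T : measurableType d} {R : realType}
  (P : probability T R) (K : nat) (Y : 'I_K -> T -> R) : Prop :=
  forall B : 'I_K -> set R, (forall j, measurable (B j)) ->
    P (\bigcap_(j in [set: 'I_K]) (Y j @^-1` B j)) =
    (\prod_(j < K) P (Y j @^-1` B j))%E.

Definition tuplewise_independent {d} {T : measurableType d} {R : realType}
  (P : probability T R) (K : nat) (X : nat -> T -> R) : Prop :=
  forall idx : 'I_K -> nat, injective idx ->
    mutually_independent P (fun j => X (idx j)).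

Definition triplewise_independent {d} {T : measurableType d} {R : realType}
  (P : probability T R) (X : nat -> T -> R) : Prop :=
  tuplewise_independent P 3 X.

Definition same_law {d d'} {T : measurableType d} {T' : measurableType d'}
  {R : realType} (P : probability T R) (X : T -> R)
  (Q : probability T' R) (W : T' -> R) : Prop :=
  forall A : set R, measurable A -> P (X @^-1` A) = Q (W @^-1` A).

Definition converges_in_law {d} {T : measurableType d} {R : realType}
  (P : probability T R) (S : nat -> T -> R) (nu : probability R R) : Prop :=
  forall f : R -> R, continuous f -> (exists M : R, forall x, `|f x| <= M) ->
    (\int[P]_w (f (S n w))%:E)%E @[n --> \oo] --> (\int[nu]_x (f x)%:E)%E.

Definition is_normal {R : realType} (nu : probability R R) : Prop :=
  exists m s : R, 0 < s /\
    forall A : set R, measurable A -> nu A = normal_prob m s A.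

(* Main.v *)
Require Import Defs.
From HB Require Import structures.
From mathcomp Require Import all_boot all_order all_algebra.
From mathcomp Require Import all_classical all_reals all_analysis.
From mathcomp Require Import measurable_realfun.
From mathcomp Require Import zify ring lra.
Import Order.TTheory GRing.Theory Num.Theory.
Import numFieldNormedType.Exports.
Local Open Scope classical_set_scope.
Local Open Scope ring_scope.

(** Let [P] be the fair coin-tossing measure on the group [nat -> bool] under
    pointwise exclusive or, and let [b, a_0, a_1, ...] be independent uniform
    elements of this group. Put [e_k = b + sum of the a_i over the binary digits
    1 of k]. Three distinct points of a vector space over the field with two
    elements are affinely independent, so the [e_k] are triplewise independent
    and uniform, and [X_k = h (e_k)] has the law of [W] when [h] is the quantile
    function of [W] read on binary digits.

    For a nontrivial character [chi] the sum of [chi (e_k)] over a dyadic block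
    of length [2 ^ m] has absolute value [prod_(i < m) (1 + chi (a_i))], whose
    expectation is 1; hence [E |sum_(k < n) chi (e_k)| = O(log n)]. Pairwise
    independence bounds the variance of partial sums, so the square integrable
    [f] with [E |sum_(k < n) (f (e_k) - E f)| = o(sqrt n)] form a closed subspace
    of L2. It contains all characters, hence the indicators of cylinders, and by
    the pi-lambda theorem it is all of L2. The standardized sums of the [X_k]
    therefore tend to 0 in L1: the limit law is the Dirac mass at 0, which is
    not normal, because a normal law is absolutely continuous. *)

(** * Binary digits and Walsh sums *)

(* The sum in the field with two elements of [z i] over the positions [i] of the
   binary digits 1 of [k]; the fuel is immaterial once it is at least [k]. *)
Fixpoint bitdot_rec (fuel k : nat) (z : nat -> bool) : bool :=
  if fuel is m.+1 then
    (odd k && z 0%N) (+) bitdot_rec m k./2 (fun i => z i.+1)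
  else false.

Definition bitdot (k : nat) (z : nat -> bool) : bool := bitdot_rec k k z.

Lemma bitdot_rec0 m z : bitdot_rec m 0 z = false.
Proof. by elim: m z => //= m IH z; rewrite IH. Qed.

Lemma bitdot_rec_fuel m n k z : (k <= m)%N -> (k <= n)%N ->
  bitdot_rec m k z = bitdot_rec n k z.
Proof.
elim: m n k z => [|m IH] [|n] k z.
- by [].
- by rewrite leqn0 => /eqP -> _; rewrite !bitdot_rec0.
- by move=> _; rewrite leqn0 => /eqP ->; rewrite !bitdot_rec0.
- by move=> km kn /=; congr (_ (+) _); apply: IH; lia.
Qed.

Lemma bitdotE k z :
  bitdot k z = (odd k && z 0%N) (+) bitdot k./2 (fun i => z i.+1).
Proof.
rewrite [LHS](bitdot_rec_fuel _ k.+1)//=.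
by congr (_ (+) _); apply: bitdot_rec_fuel; lia.
Qed.

Lemma bitdot0 z : bitdot 0 z = false. Proof. by []. Qed.

Lemma eq_bitdot k z z' : z =1 z' -> bitdot k z = bitdot k z'.
Proof. by move=> /funext ->. Qed.

(** Makes [affine k] commute with translations and lets two separating vectors be added. *)
Lemma bitdotD k z z' :
  bitdot k (fun i => z i (+) z' i) = bitdot k z (+) bitdot k z'.
Proof.
elim/ltn_ind: k z z' => -[//|k] IH z z'.
rewrite !(bitdotE k.+1) IH; last by lia.
by case: odd; case: (z 0%N); case: (z' 0%N); case: bitdot; case: bitdot.
Qed.

Lemma bitdot_andr k z b : bitdot k (fun i => z i && b) = bitdot k z && b.
Proof.
elim/ltn_ind: k z => -[//|k] IH z.
rewrite !(bitdotE k.+1) IH; last by lia.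
by case: b {IH}; rewrite ?andbT ?andbF.
Qed.

Lemma bitdot_false k : bitdot k (fun=> false) = false.
Proof. by rewrite (eq_bitdot _ _ (fun i => true && false))// bitdot_andr andbF. Qed.

(** Common low digits are stripped by halving; at the lowest digit where [k] and [l] differ, the
    indicator of that position separates them. *)
Lemma bitdot_separates k l : k <> l -> exists z, bitdot k z <> bitdot l z.
Proof.
have [m] := ubnP (k + l); elim: m k l => // m IH k l klm kl.
have [okl|okl] := eqVneq (odd k) (odd l); last first.
  exists (fun i => i == 0%N); rewrite (bitdotE k) (bitdotE l) !bitdot_false.
  by move: okl; do 2 case: odd.
have [||z hz] := IH k./2 l./2; [by lia|by lia|].
exists (fun i => if i is j.+1 then z j else false).
by rewrite (bitdotE k) (bitdotE l) !andbF.
Qed.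

(* Over the field with two elements any three distinct points are affinely
   independent. *)
Lemma bitdot_affine_dual k1 k2 k3 : k1 <> k2 -> k1 <> k3 ->
  exists b z, [/\ b (+) bitdot k1 z = true, b (+) bitdot k2 z = false &
                  b (+) bitdot k3 z = false].
Proof.
move=> /bitdot_separates[z hz] /bitdot_separates[z' hz'].
have [h|h] := eqVneq (bitdot k2 z) (bitdot k3 z).
  exists (~~ bitdot k1 z), z; rewrite -h.
  by split; move: hz; do 2 case: bitdot.
have [h'|h'] := eqVneq (bitdot k2 z') (bitdot k3 z').
  exists (~~ bitdot k1 z'), z'; rewrite h'.
  by split; move: hz'; do 2 case: bitdot.
(* In the remaining case [z] takes the same value at [k1] and [k3], and [z'] at [k1] and [k2], so
   their sum separates [k1] from both. *)
exists (~~ bitdot k1 (fun i => z i (+) z' i)), (fun i => z i (+) z' i).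
rewrite !bitdotD; split.
- by do 2 case: bitdot.
- by move: hz hz' h h'; do 6 case: bitdot.
- by move: hz hz' h h'; do 6 case: bitdot.
Qed.

(** For a character with value [(-1) ^+ z i] at [a_i], this is the sum of its values at the [e_k],
    up to the common sign contributed by [b]. *)
Definition walsh_sum {R : realType} (n : nat) (z : nat -> bool) : R :=
  \sum_(k < n) (-1) ^+ bitdot k z.

(** The [m]-th product is the absolute value of the character sum over any aligned block of [2 ^ m]
    indices; the binary expansion of an [n] below [2 ^ M] uses each length at most once. *)
Definition dyadic_majorant {R : realType} (M : nat) (z : nat -> bool) : R :=
  \sum_(m < M) \prod_(i < m) (1 + (-1) ^+ z i).

(** The indices [2k] and [2k+1] differ only in the lowest digit, so pairing them produces the factor
    [1 + (-1) ^+ z 0]. *)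
Lemma walsh_sum_double {R : realType} n z :
  walsh_sum n.*2 z = (1 + (-1) ^+ z 0%N) * walsh_sum n (fun i => z i.+1) :> R.
Proof.
elim: n => [|n IH]; first by rewrite /walsh_sum !big_ord0 mulr0.
rewrite doubleS /walsh_sum 2!big_ord_recr/= -/(walsh_sum n.*2 z) IH.
rewrite [in RHS]big_ord_recr/= -/(walsh_sum n _) mulrDr -addrA; congr (_ + _).
rewrite (bitdotE n.*2) (bitdotE n.*2.+1) /= odd_double doubleK uphalf_double /=.
by rewrite signr_addb mulrDl mul1r.
Qed.

(** Horner's scheme on the binary digits of [n]: halving pulls out a nonnegative factor, and an odd
    [n] leaves one unpaired term of absolute value 1. *)
Lemma norm_walsh_sum_le {R : realType} M n z : (n < 2 ^ M)%N ->
  `|walsh_sum n z : R| <= dyadic_majorant M z.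
Proof.
elim: M n z => [|M IH] n z.
  rewrite expn0 ltnS leqn0 => /eqP ->.
  by rewrite /walsh_sum /dyadic_majorant !big_ord0 normr0.
move=> nM.
have nM2 : (n./2 < 2 ^ M)%N by rewrite expnS in nM; lia.
have -> : dyadic_majorant M.+1 z =
    (1 + (-1) ^+ z 0%N) * dyadic_majorant M (fun i => z i.+1) + 1 :> R.
  rewrite /dyadic_majorant big_ord_recl big_ord0 addrC; congr (_ + _).
  by rewrite mulr_sumr; apply: eq_bigr => m _; rewrite big_ord_recl.
have step : `|walsh_sum n./2.*2 z : R| <=
    (1 + (-1) ^+ z 0%N) * dyadic_majorant M (fun i => z i.+1).
  rewrite walsh_sum_double normrM ger0_norm; last by case: (z 0%N) => /=; lra.
  by apply: ler_wpM2l; [case: (z 0%N) => /=; lra|exact: IH].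
have := odd_double_half n; case: odd => /=; rewrite ?add0n ?add1n => <-.
  rewrite /walsh_sum big_ord_recr/=; apply: le_trans (ler_normD _ _) _.
  by rewrite normr_sign; exact: lerD.
by apply: le_trans step _; rewrite lerDl.
Qed.

(** * The coin-tossing space *)

Definition cylinder (J : nat) (p : nat -> bool) : set (nat -> bool) :=
  [set e | forall j, (j < J)%N -> e j = p j].

(** The empty set is added because incompatible prefixes give disjoint cylinders, and the family has
    to be closed under intersection. *)
Definition cylinders : set (set (nat -> bool)) :=
  [set C | C = set0 \/ exists J p, C = cylinder J p].

Definition coins : Type := g_sigma_algebraType cylinders.

HB.instance Definition _ := Measurable.on coins.

Lemma measurable_cylinder J p : measurable (cylinder J p : set coins).
Proof. by apply: sub_sigma_algebra; right; exists J, p. Qed.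

Lemma setI_closed_cylinders : setI_closed cylinders.
Proof.
suff H J K p q : (J <= K)%N ->
    cylinders (cylinder J p `&` cylinder K q).
  move=> A B [->|[J [p ->]]]; first by rewrite set0I; left.
  move=> [->|[K [q ->]]]; first by rewrite setI0; left.
  by have [JK|/ltnW KJ] := leqP J K; [exact: H|rewrite setIC; exact: H].
move=> JK; have [h|h] := pselect (forall j, (j < J)%N -> p j = q j).
  right; exists K, q; apply/seteqP; split=> e /=; first by case.
  by move=> eq; split => // j jJ; rewrite h// eq// (leq_trans jJ).
left; apply/seteqP; split=> e //= -[ep eq]; apply: h => j jJ.
by rewrite -ep// eq// (leq_trans jJ).
Qed.

Lemma cylinder0 p : cylinder 0 p = setT.
Proof. by apply/seteqP; split. Qed.

Lemma cylinderS J p :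
  cylinder J.+1 p = cylinder J p `&` [set e | e J = p J].
Proof.
apply/seteqP; split=> e /=.
  by move=> h; split=> [j jJ|]; apply: h => //; exact: ltnW.
by move=> [h hJ] j; rewrite ltnS leq_eqVlt => /predU1P[->//|]; exact: h.
Qed.

Lemma measurable_coord j : measurable_fun setT (fun e : coins => e j).
Proof.
apply: (measurable_fun_bool true); rewrite setTI.
have -> : (fun e : coins => e j) @^-1` [set true] =
   \bigcup_(x in [set: bool ^ j])
     cylinder j.+1 (fun i => if insub i is Some i' then x i' else true).
  apply/seteqP; split=> e /=.
    move=> ej; exists [ffun i : 'I_j => e i] => // i; rewrite ltnS => ij.
    case: insubP => [i' _ <-|]; first by rewrite ffunE.
    by rewrite -leqNgt => ji; have -> : i = j by apply/eqP; rewrite eqn_leq ij.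
  by move=> [x _] /(_ j (ltnSn j)) ->; rewrite insubF// ltnn.
apply: fin_bigcup_measurable => // x _; exact: measurable_cylinder.
Qed.

Lemma measurable_coins (d : measure_display) (T : measurableType d)
    (f : T -> coins) :
  (forall j, measurable_fun setT (fun t => f t j)) -> measurable_fun setT f.
Proof.
move=> mf; apply: (measurability (cylinders : set (set coins))) => //.
move=> _ [C [->|[J [p ->]]] <-]; first by rewrite preimage_set0 setI0.
elim: J => [|J IH]; first by rewrite cylinder0 preimage_setT setTI.
rewrite cylinderS preimage_setI setIA; apply: measurableI => //.
have := mf J measurableT [set p J] I.
by rewrite setTI.
Qed.

Lemma coins_measure_unique {R : realType} (m1 m2 : {measure set coins -> \bar R}) :
  (m1 setT < +oo)%E ->
  (forall J p, m1 (cylinder J p) = m2 (cylinder J p)) ->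
  forall A, measurable A -> m1 A = m2 A.
Proof.
move=> m1T m12 A mA.
apply: (@measure_unique _ R coins cylinders (fun=> cylinder 0 xpredT)) => //.
- exact: setI_closed_cylinders.
- by move=> _; right; exists 0%N, (fun=> true).
- by rewrite bigcup_const// cylinder0.
- by move=> _ [->|[J [p ->]]]; [rewrite !measure0|exact: m12].
- by move=> _; rewrite cylinder0.
Qed.

(** * Binary digits of a real number *)

Section binary_digits.
Context {R : realType}.
Implicit Types t : R.

Definition binary_digits t : coins :=
  fun n => odd (Num.truncn (2 ^+ n.+1 * t)).

Lemma truncn_double (x : R) : 0 <= x ->
  (Num.truncn (2 * x))./2 = Num.truncn x.
Proof.
move=> x0; apply/esym/truncn_def.
have /andP[h1 h2] := truncn_itv (mulr_ge0 (ler0n R 2) x0).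
set m := Num.truncn _ in h1 h2 *.
have h3 : (m./2.*2 <= m)%N by lia.
have h4 : (m.+1 <= m./2.+1.*2)%N by lia.
rewrite -(ler_nat R) -muln2 natrM in h3.
rewrite -(ler_nat R) -muln2 natrM in h4.
by apply/andP; split; lra.
Qed.

(** The integer with binary digits [p 0, ..., p (J - 1)], most significant first, whereas [bitdot]
    reads the lowest digit first. *)
Definition dyadic_index (p : nat -> bool) : nat -> nat :=
  fix F J := if J is K.+1 then ((F K).*2 + p K)%N else 0%N.

Lemma dyadic_index_lt p J : (dyadic_index p J < 2 ^ J)%N.
Proof. by elim: J => //= J IH; rewrite expnS; case: (p J) => /=; lia. Qed.

(** [Num.truncn (2 ^+ J.+1 * t)] has half [Num.truncn (2 ^+ J * t)] and its parity is digit [J], so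
    induction on [J] rebuilds the truncation digit by digit. *)
Lemma binary_digits_cylinder t J p : 0 <= t < 1 ->
  cylinder J p (binary_digits t) <->
  Num.truncn (2 ^+ J * t) = dyadic_index p J.
Proof.
move=> /andP[t0 t1]; elim: J => [|J IH].
  rewrite cylinder0 expr0 mul1r /=; split=> // _.
  by apply: truncn_def; rewrite t0.
rewrite cylinderS /=.
have E := truncn_double _ (mulr_ge0 (exprn_ge0 J (ler0n R 2)) t0).
have {E} : (Num.truncn (2 ^+ J.+1 * t))./2 = Num.truncn (2 ^+ J * t).
  by rewrite exprS -mulrA.
rewrite /binary_digits; move: (Num.truncn (2 ^+ J.+1 * t)) => m mE.
split.
  by move=> [/IH h1 h2]; rewrite -(odd_double_half m) mE h1 h2 addnC.
move=> h; split; first by apply/IH; rewrite -mE h; case: (p J) => /=; lia.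
by rewrite h oddD odd_double /=; case: (p J).
Qed.

Lemma dyadic_indexE t J : 0 <= t < 1 ->
  dyadic_index (binary_digits t) J = Num.truncn (2 ^+ J * t).
Proof. by move=> t01; apply/esym/(binary_digits_cylinder _ _ _ t01). Qed.

Lemma measurable_binary_digits :
  measurable_fun setT (binary_digits : measurableTypeR R -> coins).
Proof.
apply: measurable_coins => n.
apply: (measurable_fun_bool true); rewrite setTI.
have -> : (fun t : measurableTypeR R => binary_digits t n) @^-1` [set true] =
    \bigcup_m ( *%R (2 ^+ n.+1)) @^-1` `[m.*2.+1%:R, m.*2.+2%:R[.
  apply/seteqP; split=> t /=; rewrite /binary_digits.
    move=> ot; have x0 : 0 <= 2 ^+ n.+1 * t.
      rewrite leNgt; apply/negP => x0; move: ot.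
      by rewrite truncn_floor leNgt x0.
    exists (Num.truncn (2 ^+ n.+1 * t))./2 => //=; rewrite in_itv/=.
    have := odd_double_half (Num.truncn (2 ^+ n.+1 * t)).
    by rewrite ot add1n => ->; exact: truncn_itv.
  move=> [m _] /=; rewrite in_itv/= => /truncn_def ->.
  by rewrite /= odd_double.
apply: bigcup_measurable => m _; rewrite -[X in measurable X]setTI.
exact: mulrl_measurable.
Qed.

End binary_digits.

Section coin_prob.
Context {R : realType}.

Let binary_digits_mfun : {mfun measurableTypeR R >-> coins} :=
  HB.pack (binary_digits : measurableTypeR R -> coins)
    (isMeasurableFun.Build _ _ (measurableTypeR R) coins _ measurable_binary_digits).

(* Only existence is exported: unfolding the concrete law makes conversion
   problems on [coin_prob] intractable. *)
Lemma coin_prob_exists : exists P : probability coins R,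
  forall (A : set coins) (B : set R), measurable A -> measurable B ->
  (forall t, 0 <= t < 1 -> A (binary_digits t) <-> B t) ->
  P A = lebesgue_measure (B `&` `[0, 1[%classic).
Proof.
(* The witness is the law of the binary digits of a uniform point of the unit interval. *)
exists (distribution (uniform_prob (@ltr01 R)) binary_digits_mfun) => A B.
move=> mA mB AB; rewrite /= /distribution /pushforward.
set A' := _ @^-1` A.
have mA' : measurable (A' : set (measurableTypeR R)).
  by rewrite -[A']setTI; exact: measurable_binary_digits.
rewrite /uniform_prob integral_uniform_pdf.
rewrite (eq_integral (fun=> 1%:E)); last first.
  by move=> x /[!inE] -[_ /=]; rewrite /uniform_pdf in_itv/= => ->; rewrite subr0 invr1.
rewrite integral_cst//=; last exact: measurableI.
(* [A] and [B] are compared only for [t < 1], while the uniform law sits on the closed interval; the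
   endpoint 1 is split off as a null set. *)
rewrite mul1e -(@setUitv1 _ _ (BLeft 0) 1 true); last by rewrite bnd_simp.
rewrite setIUr measureU0//.
- congr (lebesgue_measure _); apply/seteqP; split=> t /= [h]; rewrite in_itv/= => t01;
    by split => //; apply/(AB _ t01).
- exact: measurableI.
- exact: measurableI.
- apply: (@subset_measure0 _ _ _ lebesgue_measure _ [set (1:R)]) => //.
  + exact: measurableI.
  + exact: lebesgue_measure_set1.
Qed.

Definition coin_prob : probability coins R := sval (cid coin_prob_exists).

Lemma coin_probE (A : set coins) (B : set R) : measurable A -> measurable B ->
  (forall t, 0 <= t < 1 -> A (binary_digits t) <-> B t) ->
  coin_prob A = lebesgue_measure (B `&` `[0, 1[%classic).
Proof. exact: (svalP (cid coin_prob_exists)). Qed.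

(** In the unit interval the cylinder is the dyadic interval of length [2 ^ -J] that starts at
    [dyadic_index p J / 2 ^ J]. *)
Lemma coin_prob_cylinder J p : coin_prob (cylinder J p) = ((2 ^+ J)^-1)%:E.
Proof.
have J0 : 0 < 2 ^+ J :> R by rewrite exprn_gt0.
pose c : R := (dyadic_index p J)%:R.
have c0 : 0 <= c by rewrite ler0n.
have cJ : c + 1 <= 2 ^+ J.
  by rewrite /c natr1 -natrX ler_nat; exact: dyadic_index_lt.
rewrite (coin_probE _ (`[c / 2 ^+ J, (c + 1) / 2 ^+ J[%classic : set R))//; last 2 first.
- exact: measurable_cylinder.
- move=> t t01; rewrite (binary_digits_cylinder _ _ _ t01) /= in_itv/=.
  have /andP[t0 t1] := t01.
  rewrite ler_pdivrMr// ltr_pdivlMr// mulrC /c natr1.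
  split; first by move=> <-; apply: truncn_itv; rewrite mulr_ge0// ltW.
  by move/truncn_def.
rewrite setIidl; last first.
  move=> t /=; rewrite !in_itv/= => /andP[h1 h2]; apply/andP; split.
    by apply: le_trans h1; rewrite divr_ge0// ltW.
  by apply: lt_le_trans h2 _; rewrite ler_pdivrMr// mul1r.
rewrite lebesgue_measure_itv/= lte_fin ltr_pM2r ?invr_gt0// ltrDl ltr01.
by rewrite -EFinB -mulrBl addrAC subrr add0r mul1r.
Qed.

End coin_prob.
Arguments coin_prob R : clear implicits, simpl never.

(** * Translations of the coin-tossing group *)

Lemma measurable_addb (d : measure_display) (T : measurableType d)
    (f g : T -> bool) : measurable_fun setT f -> measurable_fun setT g ->
  measurable_fun setT (fun x => f x (+) g x).
Proof.
move=> mf mg.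
apply: (eq_measurable_fun (fun x => (f x && ~~ g x) || (~~ f x && g x))).
  by move=> x _; case: (f x); case: (g x).
by apply: measurable_or; apply: measurable_and => //; exact: measurable_neg.
Qed.

Definition translate (F : nat -> bool) (e : coins) : coins := fun n => e n (+) F n.

Lemma measurable_translate F : measurable_fun setT (translate F).
Proof.
by apply: measurable_coins => j; apply: measurable_addb => //; exact: measurable_coord.
Qed.

HB.instance Definition _ F := isMeasurableFun.Build _ _ coins coins
  (translate F) (measurable_translate F).

Lemma translate_cylinder F J p :
  translate F @^-1` cylinder J p = cylinder J (fun j => p j (+) F j).
Proof.
apply/seteqP; split=> e /= h j jJ; rewrite /translate.
  by rewrite -h// /translate -addbA addbb addbF.
by rewrite h// -addbA addbb addbF.
Qed.

Section translate_invariance.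
Context {R : realType}.
Notation P := (coin_prob R).

(** A translation permutes the cylinders of a given length, and these all have the same mass. *)
Lemma coin_prob_translate F A : measurable A -> P (translate F @^-1` A) = P A.
Proof.
move=> mA.
apply: (@coins_measure_unique R (distribution P (translate F))) => //.
  rewrite -[X in (X < _)%E]/(P (translate F @^-1` setT)).
  by rewrite preimage_setT probability_setT ltry.
move=> J p; transitivity (P (cylinder J (fun j => p j (+) F j))).
  by rewrite -translate_cylinder.
by rewrite -[RHS]/(P (cylinder J p)) !coin_prob_cylinder.
Qed.

Lemma ge0_integral_translate F (f : coins -> \bar R) : measurable_fun setT f ->
  (forall e, 0 <= f e)%E -> (\int[P]_e f (translate F e) = \int[P]_e f e)%E.
Proof.
move=> mf f0; rewrite -[LHS](@ge0_integral_distribution _ _ _ _ R P (translate F) f)//.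
by apply: eq_measure_integral => A mA _; exact: coin_prob_translate.
Qed.

Lemma integral_translate F (f : coins -> \bar R) : P.-integrable setT f ->
  (\int[P]_e f (translate F e) = \int[P]_e f e)%E.
Proof.
move=> intf; have mf := measurable_int _ intf.
rewrite [LHS]integralE [RHS]integralE; congr (_ - _)%E;
  rewrite -[RHS](ge0_integral_translate F)//.
- by apply: eq_integral => e _; rewrite !funeposE.
- exact: measurable_funepos.
- by apply: eq_integral => e _; rewrite !funenegE.
- exact: measurable_funeneg.
Qed.

(* Translating by [F] exchanges the two halves of a cylinder, so each half
   carries half of the mass; D may be conditioned on as long as it is
   invariant. *)
Lemma coin_prob_equivariant (u : coins -> coins) (D : set coins) :
  measurable_fun setT u -> measurable D ->
  (forall G, exists F, (forall e, u (translate F e) = translate G (u e)) /\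
                       translate F @^-1` D = D) ->
  forall B, measurable B -> P (u @^-1` B `&` D) = (P B * P D)%E.
Proof.
move=> mu mD H B mB.
have mpre A : measurable A -> measurable (u @^-1` A).
  by move=> mA; rewrite -[_ @^-1` _]setTI; exact: mu.
have PD : P D = (fine (P D))%:E by rewrite fineK// fin_num_measure.
have cyl J p : P (u @^-1` cylinder J p `&` D) = ((2 ^+ J)^-1%:E * P D)%E.
  elim: J p => [|J IH] p.
    by rewrite cylinder0 preimage_setT setTI expr0 invr1 mul1e.
  pose G j := j == J; pose p' j := p j (+) G j.
  have [F [uF DF]] := H G.
  have mC q : measurable (u @^-1` cylinder J.+1 q `&` D).
    by apply: measurableI => //; apply: mpre; exact: measurable_cylinder.
  have E : P (u @^-1` cylinder J.+1 p' `&` D) = P (u @^-1` cylinder J.+1 p `&` D).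
    rewrite -[RHS](coin_prob_translate F)//; congr (P _).
    rewrite preimage_setI DF -translate_cylinder; congr (_ `&` _).
    by apply/seteqP; split=> e /=; rewrite uF.
  have cylU : u @^-1` cylinder J p `&` D =
      (u @^-1` cylinder J.+1 p `&` D) `|` (u @^-1` cylinder J.+1 p' `&` D).
    rewrite -setIUl -preimage_setU; congr (_ @^-1` _ `&` _).
    apply/seteqP; split=> e /=.
      move=> h; have [eJ|eJ] := eqVneq (e J) (p J); [left|right].
        by rewrite cylinderS.
      rewrite cylinderS; split=> [j jJ|/=]; rewrite /p' /G.
        by rewrite h// (ltn_eqF jJ) addbF.
      by rewrite eqxx addbT; move: eJ; case: (e J); case: (p J).
    move=> [] h j jJ; rewrite h ?(ltnW jJ)// ?/p' /G.
    - exact: ltnW.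
    - by rewrite (ltn_eqF jJ) addbF.
    - exact: ltnW.
  have : P (u @^-1` cylinder J p `&` D) = (P (u @^-1` cylinder J.+1 p `&` D) +
      P (u @^-1` cylinder J.+1 p' `&` D))%E.
    rewrite cylU; apply: measureU => //.
    apply/seteqP; split=> e //= [[h _] [h' _]].
    have := h' J (ltnSn J); rewrite h// /p' /G eqxx addbT.
    by case: (p J).
  rewrite E IH.
  have -> : P (u @^-1` cylinder J.+1 p `&` D) =
      (fine (P (u @^-1` cylinder J.+1 p `&` D)))%:E.
    by rewrite fineK// fin_num_measure.
  rewrite PD -EFinD -!EFinM => -[h]; congr (_%:E).
  by rewrite exprS invfM -mulrA h; lra.
have PD0 : 0 <= fine (P D) by rewrite fine_ge0.
(* Uniqueness is applied to the image under [u] of [P] restricted to [D], and to [P] scaled by the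
   mass of [D]. *)
have := @coins_measure_unique R (pushforward (mrestr P mD) u)
  (mscale (NngNum PD0) P) _ _ B mB.
rewrite /= /pushforward /mrestr /mscale /= -PD muleC; apply => //.
- by rewrite preimage_setT setTI PD ltry.
- by move=> J p; rewrite cyl coin_prob_cylinder muleC.
Qed.

End translate_invariance.

(** * The triplewise independent sequence *)

Section same_law_integral.
Context (d d' dY : measure_display) (T : measurableType d) (T' : measurableType d')
  (Y : measurableType dY) (R : realType).
Context (P : {measure set T -> \bar R}) (Q : {measure set T' -> \bar R}).
Context (phi : T -> Y) (psi : T' -> Y).
Hypotheses (mphi : measurable_fun setT phi) (mpsi : measurable_fun setT psi).
Hypothesis law : forall A, measurable A -> P (phi @^-1` A) = Q (psi @^-1` A).
Local Open Scope ereal_scope.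

Lemma ge0_integral_same_law (f : Y -> \bar R) : measurable_fun setT f ->
  (forall y, 0 <= f y) -> \int[P]_x f (phi x) = \int[Q]_x f (psi x).
Proof.
move=> mf f0.
rewrite -[LHS](ge0_integral_pushforward mphi P (D := setT))//.
rewrite -[RHS](ge0_integral_pushforward mpsi Q (D := setT))//.
by apply: eq_measure_integral => A mA _; exact: law.
Qed.

Lemma integral_same_law (f : Y -> \bar R) : measurable_fun setT f ->
  \int[P]_x f (phi x) = \int[Q]_x f (psi x).
Proof.
move=> mf; rewrite [LHS]integralE [RHS]integralE; congr (_ - _).
  have := ge0_integral_same_law f^\+ (measurable_funepos mf) (funepos_ge0 f).
  by congr (_ = _); apply: eq_integral => x _; rewrite !funeposE.
have := ge0_integral_same_law f^\- (measurable_funeneg mf) (funeneg_ge0 f).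
by congr (_ = _); apply: eq_integral => x _; rewrite !funenegE.
Qed.

Lemma Lfun2_same_law (f : Y -> R) : measurable_fun setT f ->
  f \o psi \in Lfun Q 2%:E -> f \o phi \in Lfun P 2%:E.
Proof.
move=> mf; rewrite !inE => /andP[_] /[!inE]/= fin; apply/andP; split.
  by rewrite inE; exact: measurableT_comp.
rewrite inE /finite_norm/=; move: fin; rewrite /finite_norm unlock /Lnorm.
have := ge0_integral_same_law (fun y => (`|f y| `^ 2)%:E).
rewrite /= => -> //.
apply/measurable_EFinP/(measurableT_comp (measurable_powR _)).
exact: measurableT_comp.
Qed.

End same_law_integral.

(* Row 0 plays the role of [b], row [i.+1] that of [a_i], and [affine k] that of
   [e_k]. *)
Definition coin_row (e : coins) (i : nat) : coins := fun j => e (pickle (i, j)).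

Definition affine (k : nat) (e : coins) : coins :=
  fun j => coin_row e 0 j (+) bitdot k (fun i => coin_row e i.+1 j).

Lemma measurable_coin_row i : measurable_fun setT (coin_row^~ i).
Proof. by apply: measurable_coins => j; exact: measurable_coord. Qed.

Lemma measurable_bitdot (d : measure_display) (T : measurableType d) k
    (z : T -> nat -> bool) : (forall i, measurable_fun setT (z^~ i)) ->
  measurable_fun setT (fun t => bitdot k (z t)).
Proof.
elim/ltn_ind: k z => -[|k] IH z mz.
  apply: (eq_measurable_fun (cst false)) => [t _|]; first by rewrite bitdot0.
  exact: measurable_cst.
apply: (eq_measurable_fun (fun t => (odd k.+1 && z t 0%N) (+)
    bitdot k.+1./2 (fun i => z t i.+1))) => [t _|]; first by rewrite -bitdotE.
apply: measurable_addb; first by apply: measurable_and => //; exact: measurable_cst.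
by apply: (IH _ _ (fun t i => z t i.+1)) => //; lia.
Qed.

Lemma measurable_affine k : measurable_fun setT (affine k).
Proof.
apply: measurable_coins => j; apply: measurable_addb; first exact: measurable_coord.
apply: (@measurable_bitdot _ coins k (fun e i => coin_row e i.+1 j)) => i.
exact: measurable_coord.
Qed.

Lemma affine_translate k F e : affine k (translate F e) = translate (affine k F) (affine k e).
Proof.
apply/funext => j; rewrite /affine /translate /coin_row bitdotD.
by rewrite addbACA.
Qed.

(** Row 0 of [F] is [b] times [G] and row [i.+1] is [z i] times [G]. Translation by [F] thus moves
    every [e_k] by [G] times the value at [k] of the affine form given by [b] and [z]. *)
Lemma affine_lift k b z (G : nat -> bool) : let F := fun n =>
  if unpickle n is Some (i, j) then
    (if i is i'.+1 then z i' else b) && G j else false in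
  affine k F = (fun j => (b (+) bitdot k z) && G j).
Proof.
move=> F; apply/funext => j; rewrite /affine /coin_row /F.
rewrite [in X in X (+) _]pickleK (eq_bitdot _ _ (fun i => z i && G j)).
  by rewrite bitdot_andr andb_addl.
by move=> i; rewrite pickleK.
Qed.

Section affine_independence.
Context {R : realType}.
Notation P := (coin_prob R).

Lemma preimage_affine_measurable k (B : set coins) : measurable B ->
  measurable (affine k @^-1` B).
Proof. by move=> mB; rewrite -[_ @^-1` _]setTI; exact: measurable_affine. Qed.

(** An affine form equal to 1 at [k1] and 0 at [k2] and [k3] lifts every [G] to a translation that
    moves the first point by [G] and fixes the other two. The case [k2 = k3] is allowed and yields
    the laws of single points and of pairs. *)
Lemma affine_prob_split k1 k2 k3 B1 B2 B3 : k1 <> k2 -> k1 <> k3 ->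
  measurable B1 -> measurable B2 -> measurable B3 ->
  P (affine k1 @^-1` B1 `&` (affine k2 @^-1` B2 `&` affine k3 @^-1` B3)) =
  (P B1 * P (affine k2 @^-1` B2 `&` affine k3 @^-1` B3))%E.
Proof.
move=> k12 k13 mB1 mB2 mB3; apply: coin_prob_equivariant => //.
- exact: measurable_affine.
- by apply: measurableI; exact: preimage_affine_measurable.
move=> G; have [b [z [h1 h2 h3]]] := bitdot_affine_dual _ _ _ k12 k13.
set F := fun n => if unpickle n is Some (i, j) then
    (if i is i'.+1 then z i' else b) && G j else false.
have aF k : affine k F = (fun j => (b (+) bitdot k z) && G j) := affine_lift k b z G.
have translate0 (e : coins) : translate (fun=> false) e = e.
  by apply/funext => j; rewrite /translate addbF.
exists F; split=> [e|].
  by rewrite affine_translate aF h1.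
by apply/seteqP; split=> e /=; rewrite !affine_translate !aF h2 h3 !translate0.
Qed.

Lemma affine_law k B : measurable B -> P (affine k @^-1` B) = P B.
Proof.
move=> mB.
have := @affine_prob_split k k.+1 k.+1 B setT setT.
rewrite !preimage_setT !setIT probability_setT mule1; apply => //; lia.
Qed.

Lemma affine_law2 k l A B : k <> l -> measurable A -> measurable B ->
  P (affine k @^-1` A `&` affine l @^-1` B) = (P A * P B)%E.
Proof.
move=> kl mA mB; have := @affine_prob_split k l l A B setT kl kl.
by rewrite preimage_setT setIT affine_law//; apply.
Qed.

Lemma affine_law3 k1 k2 k3 B1 B2 B3 : k1 <> k2 -> k1 <> k3 -> k2 <> k3 ->
  measurable B1 -> measurable B2 -> measurable B3 ->
  P (affine k1 @^-1` B1 `&` (affine k2 @^-1` B2 `&` affine k3 @^-1` B3)) =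
  (P B1 * (P B2 * P B3))%E.
Proof. by move=> *; rewrite affine_prob_split// affine_law2. Qed.

Lemma Lfun2_affine k (f : coins -> R) :
  f \in Lfun P 2%:E -> f \o affine k \in Lfun P 2%:E.
Proof.
move=> f2; have : measurable_fun setT f by case/andP: f2 => /[!inE].
move=> mf; apply: (@Lfun2_same_law _ _ _ coins coins coins R P P _ id) => //.
- exact: measurable_affine.
- by move=> A mA; exact: affine_law.
Qed.

Lemma expectation_affine k (f : coins -> R) : measurable_fun setT f ->
  ('E_P[f \o affine k] = 'E_P[f])%E.
Proof.
move=> mf; rewrite unlock.
apply: (@integral_same_law _ _ _ coins coins coins R P P _ id _ _ _ (EFin \o f)) => //.
- exact: measurable_affine.
- by move=> A mA; exact: affine_law.
- exact/measurable_EFinP.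
Qed.

(** By pairwise independence the two points have joint law [P \x P]; Fubini then factors the
    expectation of the product. *)
Lemma covariance_affine k l (f : coins -> R) : k <> l -> f \in Lfun P 2%:E ->
  covariance P (f \o affine k) (f \o affine l) = 0%E.
Proof.
move=> kl f2.
have Pfin : P setT \is a fin_num := fin_num_measure P _ measurableT.
have mf : measurable_fun setT f by case/andP: f2 => /[!inE].
have f1 := Lfun_subset12 Pfin f2.
have /Lfun1_integrable intf := f1.
have fk := Lfun2_affine k _ f2; have fl := Lfun2_affine l _ f2.
have fkl := Lfun2_mul_Lfun1 fk fl.
have mF : measurable_fun setT (fun z : coins * coins => (f z.1 * f z.2)%:E).
  apply/measurable_EFinP; apply: measurable_funM.
    exact: measurableT_comp mf measurable_fst.
  exact: measurableT_comp mf measurable_snd.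
have law (A : set (coins * coins)) : measurable A ->
    (P \x P)%E (id @^-1` A) = P ((fun e => (affine k e, affine l e)) @^-1` A).
  have mkl : measurable_fun setT (fun e => (affine k e, affine l e)).
    by apply: measurable_fun_pair; exact: measurable_affine.
  move=> mA; apply: (@product_measure_unique _ _ coins coins R P P
    (pushforward P (fun e => (affine k e, affine l e)))) => // B C mB mC.
  exact: affine_law2.
have mkl : measurable_fun setT (fun e => (affine k e, affine l e)).
  by apply: measurable_fun_pair; exact: measurable_affine.
have intF : (P \x P)%E.-integrable setT (fun z : coins * coins => (f z.1 * f z.2)%:E).
  apply/integrableP; split => //.
  have /Lfun1_integrable/integrableP[_] := fkl; congr (_ < _)%E; apply/esym.
  apply: (@ge0_integral_same_law _ _ _ (coins * coins)%type coins (coins * coins)%type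
    R (P \x P)%E P id _ _ _ law (fun z => `|(f z.1 * f z.2)%:E|%E)) => //.
  exact: measurableT_comp.
rewrite (covarianceE (Lfun_subset12 Pfin fk) (Lfun_subset12 Pfin fl) fkl).
rewrite (expectation_affine k _ mf) (expectation_affine l _ mf).
have -> : ('E_P[((f \o affine k) * (f \o affine l))%R] = 'E_P[f] * 'E_P[f])%E.
  rewrite unlock.
  transitivity (\int[(P \x P)%E]_z (f z.1 * f z.2)%:E)%E.
    apply/esym; apply: (@integral_same_law _ _ _ (coins * coins)%type coins
      (coins * coins)%type R (P \x P)%E P id _ _ _ law
      (fun z => (f z.1 * f z.2)%:E)) => //.
  rewrite -integral12_prod_meas1// /fubini_F/=.
  under eq_integral => x _.
    under eq_integral do rewrite EFinM.
    rewrite (integralZl measurableT intf).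
    over.
  have fE : (\int[P]_y (f y)%:E)%E = (fine (\int[P]_y (f y)%:E))%:E.
    by rewrite fineK//; apply: integrable_fin_num => //; exact: intf.
  by rewrite fE (integralZr measurableT intf) fE.
by rewrite subee// fin_numM// expectation_fin_num.
Qed.

End affine_independence.

(** * Mean fluctuations of partial sums *)

Lemma Lfun2_measurable (d : measure_display) (T : measurableType d) (R : realType)
    (P : {measure set T -> \bar R}) (f : T -> R) :
  f \in Lfun P 2%:E -> measurable_fun setT f.
Proof. by case/andP => /[!inE]. Qed.

Lemma le_Lfun2 (d : measure_display) (T : measurableType d) (R : realType)
    (P : {measure set T -> \bar R}) (f g : T -> R) :
  measurable_fun setT g -> (forall x, `|g x| <= `|f x|) ->
  f \in Lfun P 2%:E -> g \in Lfun P 2%:E.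
Proof.
move=> mg gf f2; have mf := Lfun2_measurable _ _ _ _ _ f2.
move: f2; rewrite !inE => /andP[_] /[!inE]/= fin.
apply/andP; split; first by rewrite inE.
rewrite inE/= /finite_norm; apply: le_lt_trans fin; rewrite unlock /Lnorm.
have mabs (h : T -> R) : measurable_fun setT h ->
    measurable_fun setT (fun x : T => (`|h x| `^ 2)%:E : \bar R).
  move=> mh; apply/measurable_EFinP/(measurableT_comp (measurable_powR _)).
  exact: measurableT_comp.
apply: gt0_ler_poweR => //; rewrite ?in_itv/= ?leey ?integral_ge0//.
- apply: ge0_le_integral => //.
  + exact: mabs.
  + exact: mabs.
  + by move=> x _; rewrite lee_fin ge0_ler_powR// nnegrE.
Qed.

(** A substitute for Cauchy-Schwarz with a free parameter [c], obtained by integrating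
    [|y| <= y^2 / (2c) + c / 2]; it avoids the square root of the variance. *)
Lemma expectation_abs_centered_le (d : measure_display) (T : measurableType d)
    (R : realType) (P : probability T R) (X : T -> R) (c : R) :
  0 < c -> X \in Lfun P 2%:E ->
  (\int[P]_x `|X x - fine 'E_P[X]|%:E <=
   ((2 * c)^-1)%:E * 'V_P[X] + (c / 2)%:E)%E.
Proof.
move=> c0 X2; have mX := Lfun2_measurable _ _ _ _ _ X2.
set m := fine 'E_P[X]%E.
have -> : 'V_P[X]%E = (\int[P]_x ((X x - m) ^+ 2)%:E)%E.
  rewrite /variance unlock -/m unlock; apply: eq_integral => x _.
  by rewrite /= expr2.
have mXm : measurable_fun setT (fun x => X x - m) by exact: measurable_funB.
have c20 : 0 <= (2 * c)^-1 by rewrite invr_ge0 mulr_ge0// ltW.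
have msq : measurable_fun setT (fun x => (((2 * c)^-1)%:E * ((X x - m) ^+ 2)%:E)%E).
  apply: emeasurable_funM => //; apply/measurable_EFinP; exact: measurable_funX.
have -> : (c / 2)%:E = (\int[P]_x (c / 2)%:E)%E.
  by rewrite integral_cst//= probability_setT mule1.
rewrite -ge0_integralZl//; last 2 first.
- by apply/measurable_EFinP; exact: measurable_funX.
- by move=> x _; rewrite lee_fin sqr_ge0.
rewrite -ge0_integralD//; last 2 first.
- by move=> x _; rewrite mule_ge0// lee_fin sqr_ge0.
- by move=> x _; rewrite lee_fin divr_ge0// ltW.
apply: ge0_le_integral => //.
- apply/measurable_EFinP; exact: measurableT_comp.
- exact: emeasurable_funD.
move=> x _; rewrite -EFinM -EFinD lee_fin.
(* AM-GM *)
set y := X x - m; rewrite -subr_ge0 -[y ^+ 2]real_normK ?num_real//.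
have -> : (2 * c)^-1 * `|y| ^+ 2 + c / 2 - `|y| = (`|y| - c) ^+ 2 / (2 * c).
  by field; rewrite gt_eqF.
by rewrite divr_ge0 ?sqr_ge0// mulr_ge0// ltW.
Qed.

Section fluctuation.
Context {R : realType}.
Notation P := (coin_prob R).
Implicit Types f g : coins -> R.

Let Pfin : P setT \is a fin_num := fin_num_measure P _ measurableT.

Definition partial_sum f n (e : coins) : R := \sum_(k < n) f (affine k e).

Definition fluct f n (e : coins) : R := partial_sum f n e - n%:R * fine 'E_P[f].

Lemma partial_sumS f n :
  partial_sum f n.+1 = (partial_sum f n \+ (f \o affine n))%R.
Proof. by apply/funext => e; rewrite /partial_sum big_ord_recr. Qed.

Lemma partial_sum0 f : partial_sum f 0 = cst 0.
Proof. by apply/funext => e; rewrite /partial_sum big_ord0. Qed.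

Lemma Lfun2D f g : f \in Lfun P 2%:E -> g \in Lfun P 2%:E ->
  (f \+ g)%R \in Lfun P 2%:E.
Proof. by move=> f2 g2; have [_] := @Lfun_addr_closed _ _ _ P 2%:E (lee1n 2); apply. Qed.

Lemma Lfun2_partial_sum f n : f \in Lfun P 2%:E ->
  partial_sum f n \in Lfun P 2%:E.
Proof.
move=> f2; elim: n => [|n IH]; first by rewrite partial_sum0 Lfun_cst.
by rewrite partial_sumS Lfun2D// Lfun2_affine.
Qed.

Lemma expectation_partial_sum f n : f \in Lfun P 2%:E ->
  ('E_P[partial_sum f n] = n%:R%:E * 'E_P[f])%E.
Proof.
move=> f2; have mf := Lfun2_measurable _ _ _ _ _ f2.
have f1 : 'E_P[f]%E \is a fin_num by exact/expectation_fin_num/(Lfun_subset12 Pfin).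
elim: n => [|n IH]; first by rewrite partial_sum0 expectation_cst mul0e.
rewrite partial_sumS expectationD; last 2 first.
- by apply/(Lfun_subset12 Pfin)/Lfun2_partial_sum.
- by apply/(Lfun_subset12 Pfin)/Lfun2_affine.
by rewrite IH expectation_affine// -natr1 EFinD muleDl ?mul1e.
Qed.

Lemma variance_affine f k : f \in Lfun P 2%:E ->
  ('V_P[f \o affine k] = 'V_P[f])%E.
Proof.
move=> f2; have mf := Lfun2_measurable _ _ _ _ _ f2.
rewrite !varianceE//; last exact: Lfun2_affine.
rewrite expectation_affine//; congr (_ - _)%E.
have := expectation_affine k (fun e => f e ^+ 2) (measurable_funX 2 mf).
by [].
Qed.

(** Bienaymé's identity: the covariances vanish because the [e_k] are pairwise independent. *)
Lemma variance_partial_sum f n : f \in Lfun P 2%:E ->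
  ('V_P[partial_sum f n] = n%:R%:E * 'V_P[f])%E.
Proof.
move=> f2; elim: n => [|n IH]; first by rewrite partial_sum0 variance_cst mul0e.
have cov m : (m <= n)%N ->
    covariance P (partial_sum f m) (f \o affine n) = 0%E.
  elim: m => [|m IHm] mn; first by rewrite partial_sum0 covariance_cst_l.
  rewrite partial_sumS covarianceDl ?Lfun2_partial_sum ?Lfun2_affine//.
  rewrite IHm 1?ltnW// covariance_affine ?adde0//.
  by move=> mnE; rewrite mnE ltnn in mn.
rewrite partial_sumS varianceD ?Lfun2_partial_sum ?Lfun2_affine//.
rewrite cov// mule0 adde0 IH variance_affine// -natr1 EFinD muleDl ?mul1e//.
exact: variance_fin_num.
Qed.

Definition mean_fluct f n : \bar R := (\int[P]_e `|fluct f n e|%:E)%E.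

Lemma measurable_fluct f n : measurable_fun setT f ->
  measurable_fun setT (fluct f n).
Proof.
move=> mf; apply: measurable_funB => //.
elim: n => [|n IH]; first by rewrite partial_sum0; exact: measurable_cst.
rewrite partial_sumS; apply: measurable_funD => //; apply: measurableT_comp => //.
exact: measurable_affine.
Qed.

Lemma mean_fluct_le f n (c : R) : 0 < c -> f \in Lfun P 2%:E ->
  (mean_fluct f n <= ((2 * c)^-1 * n%:R)%:E * 'V_P[f] + (c / 2)%:E)%E.
Proof.
move=> c0 f2; rewrite EFinM -muleA -variance_partial_sum//.
apply: le_trans (expectation_abs_centered_le _ _ _ _ _ _ c0 (Lfun2_partial_sum _ n f2)).
rewrite le_eqVlt; apply/orP; left; apply/eqP; apply: eq_integral => e _.
rewrite expectation_partial_sum// fineM//.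
by apply: expectation_fin_num; exact: Lfun_subset12.
Qed.

Definition vanishing f := f \in Lfun P 2%:E /\
  forall eps : R, 0 < eps ->
    \forall n \near \oo, (mean_fluct f n <= (eps * Num.sqrt n%:R)%:E)%E.

Lemma fluctD f g n e : f \in Lfun P 2%:E -> g \in Lfun P 2%:E ->
  fluct (f \+ g) n e = fluct f n e + fluct g n e.
Proof.
move=> f2 g2.
rewrite /fluct expectationD ?(Lfun_subset12 Pfin)// fineD; last 2 first.
- by apply: expectation_fin_num; exact: Lfun_subset12.
- by apply: expectation_fin_num; exact: Lfun_subset12.
by rewrite /partial_sum/= big_split/=; ring.
Qed.

Lemma mean_fluctD f g n : f \in Lfun P 2%:E -> g \in Lfun P 2%:E ->
  (mean_fluct (f \+ g)%R n <= mean_fluct f n + mean_fluct g n)%E.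
Proof.
move=> f2 g2.
have mf := Lfun2_measurable _ _ _ _ _ f2; have mg := Lfun2_measurable _ _ _ _ _ g2.
have mfl h : measurable_fun setT h ->
    measurable_fun setT (fun e => (`|fluct h n e|%:E : \bar R)).
  move=> mh; apply/measurable_EFinP/measurableT_comp => //.
  exact: measurable_fluct.
rewrite /mean_fluct -ge0_integralD//; [|exact: mfl|exact: mfl].
apply: ge0_le_integral => //.
- by apply: mfl; exact: measurable_funD.
- by apply: emeasurable_funD; exact: mfl.
- by move=> e _; rewrite -EFinD lee_fin fluctD// ler_normD.
Qed.

Lemma vanishingD f g : vanishing f -> vanishing g -> vanishing (f \+ g).
Proof.
move=> [f2 vf] [g2 vg]; split; first exact: Lfun2D.
move=> eps eps0; have eps20 : 0 < eps / 2 by rewrite divr_gt0.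
near=> n.
have -> : (eps * Num.sqrt n%:R)%:E =
    ((eps / 2 * Num.sqrt n%:R)%:E + (eps / 2 * Num.sqrt n%:R)%:E)%E.
  by rewrite -EFinD; congr (_%:E); field.
apply: le_trans (mean_fluctD _ _ _ f2 g2) _.
by apply: leeD; near: n; [exact: vf|exact: vg].
Unshelve. all: by end_near. Qed.

Lemma vanishingZ f (c : R) : vanishing f -> vanishing (fun e => f e * c).
Proof.
move=> [f2 vf]; have mf := Lfun2_measurable _ _ _ _ _ f2.
have cf2 : (fun e => f e * c) \in Lfun P 2%:E.
  by have := @Lfun_scale _ _ _ P f c 2 _ f2; rewrite ler1n; apply.
split=> // eps eps0.
have cE n e : fluct (fun e => f e * c) n e = fluct f n e * c.
  rewrite /fluct /partial_sum -mulr_suml mulrBl.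
  have -> : fine 'E_P[(fun e => (f e * c)%R)]%E = fine 'E_P[f]%E * c.
    have -> := @expectationZl _ _ _ P f c (Lfun_subset12 Pfin f2).
    rewrite fineM// 1?mulrC//.
    by apply: expectation_fin_num; exact: Lfun_subset12.
  by rewrite mulrA.
(* The added 1 keeps the divisor positive when [c] is 0. *)
have c1 : 0 < `|c| + 1 by rewrite ltr_wpDl.
have [|N _ vN] := vf (eps / (`|c| + 1)); first by rewrite divr_gt0.
exists N => // n /= Nn; rewrite /mean_fluct.
have -> : (\int[P]_e `|fluct (fun e => (f e * c)%R) n e|%:E = `|c|%:E * mean_fluct f n)%E.
  rewrite /mean_fluct -ge0_integralZl//; last first.
    by apply/measurable_EFinP/measurableT_comp => //; exact: measurable_fluct.
  by apply: eq_integral => e _; rewrite cE normrM mulrC EFinM.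
apply: le_trans (lee_wpmul2l _ (vN _ Nn)) _ => //.
rewrite -EFinM lee_fin mulrA; apply: ler_wpM2r => //.
rewrite mulrCA ler_piMr ?(ltW eps0)// ler_pdivrMr// mul1r lerDl//.
Qed.

Lemma vanishing_cst (c : R) : vanishing (cst c).
Proof.
split; first exact: Lfun_cst.
move=> eps eps0; near=> n; rewrite /mean_fluct.
under eq_integral => e _.
  rewrite /fluct /partial_sum expectation_cst/= sumr_const card_ord mulr_natl.
  rewrite subrr normr0; over.
by rewrite integral0 lee_fin mulr_ge0// ltW.
Unshelve. all: by end_near. Qed.

Lemma vanishingB f g : vanishing f -> vanishing g -> vanishing (f \- g).
Proof.
move=> vf vg; have := vanishingD _ _ vf (vanishingZ _ (-1) vg).
by congr vanishing; apply/funext => e /=; rewrite mulrN1.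
Qed.

Lemma vanishing_sum (I : eqType) (r : seq I) (F : I -> coins -> R) :
  (forall i, i \in r -> vanishing (F i)) -> vanishing (fun e => \sum_(i <- r) F i e).
Proof.
elim: r => [|i r IH] vF.
  by under eq_fun do rewrite big_nil; exact: vanishing_cst.
under eq_fun do rewrite big_cons; apply: vanishingD.
  by apply: vF; rewrite mem_head.
by apply: IH => j jr; apply: vF; rewrite in_cons jr orbT.
Qed.

(** Split [f] as [(f - g) + g]. The fluctuation of [g] is negligible; that of [f - g] is controlled
    by its variance, hence by the L2 distance, uniformly in [n] on the scale [sqrt n]. *)
Lemma vanishing_closed f : f \in Lfun P 2%:E ->
  (forall eps : R, 0 < eps -> exists2 g, vanishing g &
     (\int[P]_e ((f e - g e) ^+ 2)%:E <= eps%:E)%E) ->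
  vanishing f.
Proof.
move=> f2 H; split=> // eps eps0.
have d0 : 0 < eps / 2 by rewrite divr_gt0.
have [|g [g2 vg] fg] := H ((eps / 2) ^+ 2); first by rewrite exprn_gt0.
have h2 : (f \- g)%R \in Lfun P 2%:E.
  have -> : (f \- g)%R = (f \+ (-1) \o* g)%R.
    by apply/funext => e /=; rewrite mulrN1.
  by apply: Lfun2D => //; apply: Lfun_scale => //; rewrite ler1n.
near=> n.
have n0 : 0 < n%:R :> R by rewrite ltr0n; near: n; exact: nbhs_infty_gt.
have -> : (eps * Num.sqrt n%:R)%:E =
    ((eps / 2 * Num.sqrt n%:R)%:E + (eps / 2 * Num.sqrt n%:R)%:E)%E.
  by rewrite -EFinD; congr (_%:E); field.
rewrite [f](_ : _ = ((f \- g) \+ g)%R); last first.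
  by apply/funext => e /=; rewrite subrK.
apply: le_trans (mean_fluctD _ _ _ h2 g2) _.
apply: leeD; last by near: n; exact: vg.
have V : ('V_P[(f \- g)%R] <= ((eps / 2) ^+ 2)%:E)%E.
  rewrite varianceE//; apply: le_trans fg.
  rewrite [X in (X - _)%E](_ : _ = \int[P]_e ((f e - g e) ^+ 2)%:E)%E; last first.
    by rewrite unlock.
  rewrite -[('E_P[_])%E]fineK; last first.
    by apply: expectation_fin_num; exact: Lfun_subset12.
  by rewrite -EFin_expe leeBlDr// leeDl// lee_fin sqr_ge0.
have s0 : 0 < Num.sqrt n%:R :> R by rewrite sqrtr_gt0.
(* With this [c] and the variance bound [V], both terms of [mean_fluct_le] become [c / 2]. *)
have c0 : 0 < eps / 2 * Num.sqrt n%:R by rewrite mulr_gt0.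
apply: le_trans (mean_fluct_le _ n _ c0 h2) _.
apply: le_trans (leeD (lee_wpmul2l _ V) (lexx _)) _.
  by rewrite lee_fin mulr_ge0// invr_ge0 mulr_ge0// ltW.
have ns : n%:R = Num.sqrt n%:R ^+ 2 :> R by rewrite sqr_sqrtr ?ler0n.
move: (Num.sqrt n%:R) ns s0 => s -> s0.
rewrite -EFinM -EFinD lee_fin le_eqVlt; apply/orP; left; apply/eqP; field.
by rewrite !gt_eqF.
Unshelve. all: by end_near. Qed.

End fluctuation.

(** * Density of the Walsh functions *)

(** At [m = 3] both sides equal 64, which fixes the constant 8; from there on the left side grows by
    a factor below 2 at each step. *)
Lemma leq_cube_pow2 m : (m.+1 ^ 3 <= 8 * 2 ^ m)%N.
Proof.
have [m3|m3] := ltnP m 3; first by case: m m3 => [|[|[|]]].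
rewrite -(subnK m3); elim: (m - 3)%N => // n IH.
rewrite addSn [(2 ^ _)%N]expnS; move: IH; rewrite !expnS expn0; nia.
Qed.

(** Let [M] be the number of binary digits of [n]. Then [M ^ 3 <= 8 n], and once [M >= 8 / eps ^ 2]
    this gives [M ^ 2 <= eps ^ 2 n]. *)
Lemma trunc_log_negligible {R : realType} (eps : R) : 0 < eps ->
  \forall n \near \oo, (trunc_log 2 n).+1%:R <= eps * Num.sqrt n%:R :> R.
Proof.
move=> eps0; pose K := (Num.truncn (8 / eps ^+ 2)).+1.
have hK : 8 / eps ^+ 2 <= K%:R by exact/ltW/truncnS_gt.
exists (2 ^ K)%N => // n /= Kn.
have n0 : (0 < n)%N by apply: leq_trans Kn; rewrite expn_gt0.
set M := (trunc_log 2 n).+1.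
have KM : (K <= M)%N by rewrite leqW// trunc_log_max.
have M3 : (M ^ 3 <= 8 * n)%N.
  apply: leq_trans (leq_cube_pow2 _) _.
  by rewrite leq_mul2l trunc_logP.
have {}KM : 8 / eps ^+ 2 <= M%:R by apply: le_trans hK _; rewrite ler_nat.
rewrite -(ler_nat R) natrX natrM in M3.
have M0 : 0 < M%:R :> R by rewrite ltr0n.
have e20 : 0 < eps ^+ 2 by rewrite exprn_gt0.
rewrite ler_pdivrMr// in KM.
rewrite -ler_sqr ?nnegrE ?mulr_ge0 ?sqrtr_ge0 ?ler0n ?(ltW eps0)//.
rewrite exprMn sqr_sqrtr ?ler0n// -(ler_pM2l M0) -exprS.
apply: le_trans M3 _; rewrite mulrA; apply: ler_wpM2r => //.
Qed.

(** The exponent of a Walsh character. Repeated positions cancel in pairs, so a nonempty list may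
    give the trivial character; nontriviality is therefore expressed by a witness [F] with
    [parity A F]. *)
Definition parity (A : seq nat) (e : nat -> bool) : bool :=
  foldr (fun j b => e j (+) b) false A.

Lemma parity_translate A F e : parity A (translate F e) = parity A e (+) parity A F.
Proof. by elim: A => //= j A ->; rewrite /translate addbACA. Qed.

(** The value of a character at [e_k] depends only on its values at [b] and the [a_i], which turns
    sums over [k] into a [walsh_sum]. *)
Lemma parity_affine A k e : parity A (affine k e) =
  parity A (coin_row e 0) (+) bitdot k (fun i => parity A (coin_row e i.+1)).
Proof.
elim: A => [|j A IH] /=; first by rewrite bitdot_false.
by rewrite IH /affine bitdotD addbACA.
Qed.

Lemma measurable_parity A : measurable_fun setT (fun e : coins => parity A e).
Proof.
elim: A => [|j A IH]; first exact: measurable_cst.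
by apply: measurable_addb => //; exact: measurable_coord.
Qed.

Section walsh.
Context {R : realType}.
Notation P := (coin_prob R).

Definition walsh (A : seq nat) (e : coins) : R := (-1) ^+ parity A e.

Lemma measurable_sign (d : measure_display) (T : measurableType d)
    (b : T -> bool) : measurable_fun setT b ->
  measurable_fun setT (fun t => (-1) ^+ b t : R).
Proof.
move=> mb; apply: (eq_measurable_fun (fun t => if b t then -1 else 1 : R)).
  by move=> t _; case: (b t).
exact: measurable_fun_ifT.
Qed.

Lemma Lfun2_bounded (f : coins -> R) : measurable_fun setT f ->
  (forall e, `|f e| <= 1) -> f \in Lfun P 2%:E.
Proof.
move=> mf f1; apply: (@le_Lfun2 _ _ _ P (cst 1)) => //.
  by move=> e; rewrite /= normr1.
exact: Lfun_cst.
Qed.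

Lemma Lfun2_walsh A : walsh A \in Lfun P 2%:E.
Proof.
apply: Lfun2_bounded => [|e]; last by rewrite normr_sign.
by apply: measurable_sign; exact: measurable_parity.
Qed.

Section nontrivial.
Context (A : seq nat) (F : nat -> bool) (AF : parity A F).

Let row_parity (e : coins) i := parity A (coin_row e i.+1).

(** Translation by [bump m] adds [F] to row [m.+1] alone, so it flips the sign of the character at
    [a_m] and at no other [a_i]. *)
Let bump m : nat -> bool := fun n =>
  if unpickle n is Some (i, j) then (i == m.+1) && F j else false.

Let row_parity_bump m e i : row_parity (translate (bump m) e) i =
  row_parity e i (+) (i == m).
Proof.
rewrite /row_parity -[coin_row (translate _ e) _]/(translate (coin_row (bump m) i.+1) (coin_row e i.+1)).
rewrite parity_translate; congr (_ (+) _).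
have -> : coin_row (bump m) i.+1 = (fun j => (i == m) && F j).
  by apply/funext => j; rewrite /coin_row /bump pickleK eqSS.
by case: eqP => _ //=; elim: (A) => //= j B ->.
Qed.

Let measurable_row_parity i : measurable_fun setT (row_parity^~ i).
Proof.
apply: (measurableT_comp (measurable_parity A)); exact: measurable_coin_row.
Qed.

(** Translation by [F] preserves the measure and changes the sign of the character, so the mean
    equals its own negative. *)
Lemma expectation_walsh0 : 'E_P[walsh A]%E = 0%E.
Proof.
have /Lfun1_integrable intw : walsh A \in Lfun P 1.
  by apply: Lfun_subset12 (Lfun2_walsh A); exact: fin_num_measure.
rewrite unlock.
have := integral_translate F _ intw; rewrite /=.
under eq_integral.
  move=> e _; rewrite /walsh parity_translate AF addbT signrN EFinN; over.
rewrite integralN; last exact: integrable_add_def.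
have /fineK <- : (\int[P]_e ((-1) ^+ parity A e)%:E)%E \is a fin_num.
  exact: integrable_fin_num.
by rewrite -EFinN => -[h]; congr (_%:E); move: h; rewrite /walsh; lra.
Qed.

Let prodz m (e : coins) : R := \prod_(i < m) (1 + (-1) ^+ row_parity e i).

Let sign1_ge0 (b : bool) : 0 <= 1 + (-1) ^+ b :> R.
Proof. by case: b => /=; lra. Qed.

Let prodz_ge0 m e : 0 <= prodz m e.
Proof. exact: prodr_ge0. Qed.

Let measurable_prodz m : measurable_fun setT (prodz m).
Proof.
elim: m => [|m IH].
  have -> : prodz 0 = cst 1 by apply/funext => e; rewrite /prodz big_ord0.
  exact: measurable_cst.
have -> : prodz m.+1 = prodz m \* (fun e => 1 + (-1) ^+ row_parity e m).
  by apply/funext => e; rewrite /prodz big_ord_recr.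
apply: measurable_funM => //; apply: measurable_funD => //.
exact: measurable_sign.
Qed.

(* Flipping the sign of the last factor exchanges 1 + s and 1 - s, whose sum is 2. *)
Let integral_prodz m : (\int[P]_e (prodz m e)%:E = 1)%E.
Proof.
elim: m => [|m IH].
  under eq_integral do rewrite /prodz big_ord0.
  by rewrite integral_cst//= probability_setT mule1.
have E : (\int[P]_e (prodz m.+1 e)%:E + \int[P]_e (prodz m.+1 e)%:E = 2%:E)%E.
  rewrite -{2}(ge0_integral_translate (bump m) (EFin \o prodz m.+1))//; last 2 first.
  - exact/measurable_EFinP.
  - by move=> e; rewrite lee_fin.
  rewrite -ge0_integralD//; last 4 first.
  - by move=> e _; rewrite lee_fin.
  - exact/measurable_EFinP.
  - by move=> e _; rewrite lee_fin.
  - apply/measurable_EFinP; apply: measurableT_comp => //; exact: measurable_translate.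
  transitivity (\int[P]_e (2%:E * (prodz m e)%:E))%E.
    apply: eq_integral => e _; rewrite -EFinD -EFinM; congr (_%:E).
    rewrite /prodz !big_ord_recr/= row_parity_bump eqxx addbT signrN.
    rewrite [X in _ + X * _](eq_bigr (fun i : 'I_m => 1 + (-1) ^+ row_parity e i)).
      by set Z := \prod_(i < m) _; ring.
    by move=> i _; rewrite row_parity_bump ltn_eqF ?addbF.
  rewrite ge0_integralZl ?IH ?mule1//.
  - exact/measurable_EFinP.
  - by move=> e _; rewrite lee_fin.
move: E; case: (\int[P]_e (prodz m.+1 e)%:E)%E => // r.
by rewrite -EFinD => -[h]; congr (_%:E); lra.
Qed.

(** The common sign from [b] disappears in absolute value; what remains is a [walsh_sum] at the row
    parities, bounded by a sum of [M] products of mean 1 each. *)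
Lemma mean_fluct_walsh_le n M : (n < 2 ^ M)%N ->
  (mean_fluct (walsh A) n <= M%:R%:E)%E.
Proof.
move=> nM.
have -> : (M%:R%:E = \int[P]_e (\sum_(m < M) (prodz m e)%:E))%E.
  rewrite ge0_integral_sum//.
  - by under eq_bigr do rewrite integral_prodz; rewrite sumEFin sumr_const card_ord.
  - by move=> m; exact/measurable_EFinP.
  - by move=> m e _; rewrite lee_fin.
apply: ge0_le_integral => //.
- apply/measurable_EFinP/measurableT_comp => //; apply: measurable_fluct.
  by apply: measurable_sign; exact: measurable_parity.
- by apply: emeasurable_sum => m; exact/measurable_EFinP.
move=> e _; rewrite sumEFin lee_fin.
apply: le_trans (norm_walsh_sum_le M n (row_parity e) nM).
rewrite /fluct expectation_walsh0/= mulr0 subr0 /partial_sum /walsh_sum.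
under eq_bigr do rewrite /walsh parity_affine signr_addb.
by rewrite -mulr_sumr normrM normr_sign mul1r.
Qed.

End nontrivial.

Lemma vanishing_walsh A : vanishing (walsh A).
Proof.
have [[F AF]|nA] := pselect (exists F, parity A F).
  split; first exact: Lfun2_walsh.
  move=> eps eps0; near=> n.
  apply: le_trans (mean_fluct_walsh_le A F AF n (trunc_log 2 n).+1 _) _.
    by rewrite trunc_log_ltn.
  by rewrite lee_fin; near: n; exact: trunc_log_negligible.
(* A character that never takes the value -1 is constant, and constants do not fluctuate. *)
have -> : walsh A = cst 1; last exact: vanishing_cst.
apply/funext => e; rewrite /walsh.
by have [h|//] := boolP (parity A e); exfalso; apply: nA; exists e.
Unshelve. all: by end_near. Qed.

(** The indicator of [e J = p J] is [(1 + (-1) ^+ p J * (-1) ^+ e J) / 2], and the factor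
    [(-1) ^+ e J] turns [walsh A] into [walsh (J :: A)]; hence the general [A] in the induction. *)
Lemma vanishing_cylinder_walsh J p A :
  vanishing (fun e => \1_(cylinder J p) e * walsh A e).
Proof.
elim: J A => [|J IH] A.
  have -> : (fun e => \1_(cylinder 0 p) e * walsh A e) = walsh A.
    by apply/funext => e; rewrite cylinder0 indicT mul1r.
  exact: vanishing_walsh.
have := vanishingD _ _ (vanishingZ _ 2^-1 (IH A))
  (vanishingZ _ ((-1) ^+ p J / 2) (IH (J :: A))).
congr vanishing; apply/funext => e /=.
rewrite cylinderS !indicE in_setI /walsh/= signr_addb.
have -> : (e \in [set e | e J = p J]) = (e J == p J).
  by apply/idP/eqP; rewrite inE.
case: (e \in _) => /=; last by rewrite !mul0r addr0.
by case: (e J); case: (p J) => /=; field.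
Qed.

Lemma vanishing_cylinder J p : vanishing (\1_(cylinder J p) : coins -> R).
Proof.
have := vanishing_cylinder_walsh J p [::]; congr vanishing.
by apply/funext => e; rewrite /walsh mulr1.
Qed.

Lemma Lfun2_indic (B : set coins) : measurable B -> (\1_B : coins -> R) \in Lfun P 2%:E.
Proof.
move=> mB; apply: Lfun2_bounded => [|e]; first exact: measurable_indic.
by rewrite indicE; case: (_ \in _); rewrite ?normr1 ?normr0.
Qed.

(** The squared L2 distance between the indicators of the union and of [D N] is the mass of the
    difference, which tends to 0 by continuity from above. *)
Lemma vanishing_indic_bigcup (D : (set coins)^nat) : nondecreasing_seq D ->
  (forall n, measurable (D n)) -> (forall n, vanishing (\1_(D n) : coins -> R)) ->
  vanishing (\1_(\bigcup_n D n) : coins -> R).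
Proof.
move=> ndD mD vD.
have mUD : measurable (\bigcup_n D n) by exact: bigcup_measurable.
apply: vanishing_closed; first exact: Lfun2_indic.
move=> eps eps0.
have : (P (\bigcup_n D n `\` D m) @[m --> \oo] --> P set0).
  have -> : set0 = \bigcap_m (\bigcup_n D n `\` D m).
    apply/seteqP; split=> // e /= h; have [[n _ Dne] _] := h 0%N I.
    by have [_] := h n I; apply.
  apply: nonincreasing_cvg_mu => //.
  * by rewrite -ge0_fin_numE// fin_num_measure//; exact: measurableD.
  * by move=> m; exact: measurableD.
  * by apply: bigcap_measurable => // m _; exact: measurableD.
  * by move=> m n mn; apply/subsetPset; apply: setDS; apply/subsetPset; exact: ndD.
rewrite measure0 => /fine_cvgP[_ /cvgrPdist_le/(_ _ eps0)[N _ /(_ N (leqnn N))]].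
rewrite /= sub0r normrN ger0_norm ?fine_ge0// => hN.
exists (\1_(D N)); first exact: vD.
have -> : (\int[P]_e ((\1_(\bigcup_n D n) e - \1_(D N) e) ^+ 2)%:E =
    \int[P]_e (\1_(\bigcup_n D n `\` D N) e)%:E)%E.
  apply: eq_integral => e _; congr (_%:E); rewrite !indicE in_setD.
  case: (boolP (e \in D N)) => eD /=; last first.
    by rewrite andbT subr0; case: (_ \in _); rewrite ?expr1n ?expr0n.
  have -> : e \in \bigcup_n D n by rewrite inE; exists N => //; rewrite -in_setE.
  by rewrite subrr expr0n.
rewrite integral_indic ?setIT//; last exact: measurableD.
rewrite -[leLHS]fineK ?lee_fin//.
by rewrite fin_num_measure//; exact: measurableD.
Qed.

Lemma vanishing_indic (B : set coins) : measurable B -> vanishing (\1_B : coins -> R).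
Proof.
pose H : set (set coins) := [set C | measurable C /\ vanishing (\1_C : coins -> R)].
suff: <<s cylinders >> `<=` H by move=> HH mB; case: (HH _ mB).
apply: lambda_system_subset => //.
- exact: setI_closed_cylinders.
- split => //.
  + split => //; rewrite (_ : \1_setT = cst 1); first exact: vanishing_cst.
    by apply/funext => e; rewrite indicT.
  + move=> C D DC [mC vC] [mD vD]; split; first exact: measurableD.
    have := vanishingB _ _ vC vD; congr vanishing; apply/funext => e /=.
    rewrite !indicE in_setD; case: (boolP (e \in D)) => eD /=.
      have -> : e \in C by rewrite inE; apply: DC; rewrite -in_setE.
      by rewrite subrr.
    by rewrite andbT subr0.
  + move=> D ndD HD; split; first by apply: bigcup_measurable => n _; case: (HD n).
    by apply: vanishing_indic_bigcup => // n; case: (HD n).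
- move=> C [->|[J [p ->]]].
    split => //; rewrite (_ : \1_set0 = cst 0); first exact: vanishing_cst.
    by apply/funext => e; rewrite indic0.
  by split; [exact: measurable_cylinder|exact: vanishing_cylinder].
Qed.

Import HBNNSimple.

Lemma vanishing_nnsfun (g : {nnsfun coins >-> R}) : vanishing g.
Proof.
have -> : (g : coins -> R) = (fun e => \sum_(y <- finmap.enum_fset (fset_set (range g)))
    \1_(g @^-1` [set y]) e * y).
  apply/funext => e; rewrite fimfunE fsbig_finite//.
  by apply: eq_bigr => y _; rewrite mulrC.
apply: vanishing_sum => y _; apply: vanishingZ; apply: vanishing_indic.
exact: measurable_sfunP.
Qed.

(** Simple functions increase to [f], and [f ^+ 2] dominates the squared errors, so the convergence
    holds in L2. *)
Lemma vanishing_ge0 (f : coins -> R) : f \in Lfun P 2%:E ->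
  (forall e, 0 <= f e) -> vanishing f.
Proof.
move=> f2 f0; have mf := Lfun2_measurable _ _ _ _ _ f2.
have mfE : measurable_fun setT (EFin \o f) by exact/measurable_EFinP.
pose g := nnsfun_approx measurableT mfE.
have gf e : g n e @[n --> \oo] --> f e.
  have := @cvg_nnsfun_approx _ _ _ _ measurableT _ mfE (fun e _ => f0 e) e I.
  by move/fine_cvgP => [_].
have g_le n e : g n e <= f e.
  have nd : nondecreasing_seq (g ^~ e).
    by move=> m k mk; have /lefP := nd_nnsfun_approx measurableT mfE mk.
  by have := nondecreasing_cvgn_le nd (cvgP _ (gf e)) n; rewrite (cvg_lim _ (gf e)).
apply: vanishing_closed => // eps eps0.
have mfg n : measurable_fun setT (fun e => ((f e - g n e) ^+ 2)%:E : \bar R).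
  by apply/measurable_EFinP; apply: measurable_funX; exact: measurable_funB.
have [||_ _] := @dominated_convergence _ _ _ P _ measurableT
  (fun n e => ((f e - g n e) ^+ 2)%:E) (cst 0%E) (fun e => (f e ^+ 2)%:E) mfg
  (measurable_cst _) _ (Lfun2_integrable_sqr f2).
- apply: aeW => e _; apply/fine_cvgP; split; first by apply: nearW.
  rewrite [X in _ --> X](_ : _ = (f e - f e) ^+ 2); last by rewrite subrr expr0n.
  have h : (f e - g n e) @[n --> \oo] --> f e - f e by apply: cvgB => //; exact: cvg_cst.
  exact: (cvgM h h).
- apply: aeW => e n _; rewrite gee0_abs lee_fin ?sqr_ge0//.
  rewrite ler_sqr ?nnegrE ?subr_ge0// gerBl//.
rewrite /= integral0 => /fine_cvgP[fn /cvgrPdist_le/(_ _ eps0) small].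
have [N _ hN] : \forall n \near \oo,
    (\int[P]_e ((f e - g n e) ^+ 2)%:E)%E \is a fin_num /\
    `|0 - fine (\int[P]_e ((f e - g n e) ^+ 2)%:E)%E| <= eps.
  by near=> n; split; near: n.
have [h1 h2] := hN N (leqnn N); exists (g N); first exact: vanishing_nnsfun.
rewrite -[leLHS]fineK// lee_fin; move: h2.
by rewrite sub0r normrN ger0_norm// fine_ge0// integral_ge0// => e _; rewrite lee_fin sqr_ge0.
Unshelve. all: by end_near. Qed.

Lemma vanishing_Lfun2 (f : coins -> R) : f \in Lfun P 2%:E -> vanishing f.
Proof.
move=> f2; have mf := Lfun2_measurable _ _ _ _ _ f2.
have -> : f = ((fun e => Num.max (f e) 0) \- (fun e => Num.max (- f e) 0))%R.
  apply/funext => e /=; rewrite /Num.max.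
  by case: ltP => h1; case: ltP => h2; lra.
apply: vanishingB; apply: vanishing_ge0 => [|e].
- apply: (@le_Lfun2 _ _ _ P f) => // [|e]; first exact: measurable_maxr.
  by rewrite ger0_norm ?le_max ?lexx ?orbT// ge_max ler_norm normr_ge0.
- by rewrite le_max lexx orbT.
- apply: (@le_Lfun2 _ _ _ P f) => // [|e].
    by apply: measurable_maxr => //; exact: measurable_funN.
  by rewrite ger0_norm ?le_max ?lexx ?orbT// ge_max -normrN ler_norm normr_ge0.
- by rewrite le_max lexx orbT.
Qed.

End walsh.

(** * Quantile function *)

Lemma eq_measure_off (d : measure_display) (T : measurableType d) (R : realType)
    (P : {measure set T -> \bar R}) (N A B : set T) :
  measurable N -> measurable A -> measurable B -> P N = 0%E ->
  (forall x, ~ N x -> A x <-> B x) -> P A = P B.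
Proof.
move=> mN mA mB N0 AB.
rewrite -[LHS](measureU0 mA mN N0) -[RHS](measureU0 mB mN N0); congr (P _).
apply/seteqP; split=> x /= [h|]; try by right.
- by have [|/AB] := pselect (N x); [right|move=> [+ _] => /(_ h); left].
- by have [|/AB] := pselect (N x); [right|move=> [_ +] => /(_ h); left].
Qed.

Section quantile.
Context {R : realType}.
Notation P := (coin_prob R).

Definition dyadic_value J (e : coins) : R := (dyadic_index e J)%:R / 2 ^+ J.

(** The event that the real number with binary digits [e] is at most [c]; the finite truncations
    increase to that number, so no limit has to be taken. *)
Definition below (c : R) : set coins := [set e | forall J, dyadic_value J e <= c].

Lemma measurable_dyadic_index J :
  measurable_fun setT (fun e : coins => (dyadic_index e J)%:R : R).
Proof.
elim: J => [|J IH]; first exact: measurable_cst.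
apply: (eq_measurable_fun (fun e : coins =>
    2 * (dyadic_index e J)%:R + (if e J then 1 else 0) : R)).
  by move=> e _; rewrite /= natrD -muln2 natrM mulrC; case: (e J).
apply: measurable_funD; first exact: measurable_funM.
by apply: measurable_fun_ifT => //; exact: measurable_coord.
Qed.

Lemma measurable_below c : measurable (below c).
Proof.
rewrite (_ : below c = \bigcap_J (dyadic_value J @^-1` `]-oo, c])); last first.
  apply/seteqP; split=> e /= h J; first by move=> _ /=; rewrite in_itv/=.
  by have := h J I; rewrite /= in_itv.
apply: bigcap_measurable => // J _; rewrite -[X in measurable X]setTI.
have : measurable_fun setT (dyadic_value J).
  by apply: measurable_funM => //; exact: measurable_dyadic_index.
by apply.
Qed.

(** For the digits of [t], the truncations [floor (2 ^ J t) / 2 ^ J] approach [t] from below, so the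
    event becomes [t <= c]. *)
Lemma coin_prob_below (c : R) : 0 <= c <= 1 -> P (below c) = c%:E.
Proof.
move=> /andP[c0 c1].
rewrite (coin_probE _ (`]-oo, c]%classic : set R))//; last 2 first.
- exact: measurable_below.
- move=> t t01; have /andP[t0 t1] := t01; rewrite /below /= in_itv/=; split; last first.
    move=> tc J; apply: le_trans tc; rewrite /dyadic_value dyadic_indexE//.
    by rewrite ler_pdivrMr ?exprn_gt0// mulrC truncn_le mulr_ge0// exprn_ge0.
  move=> h; rewrite leNgt; apply/negP => ct.
  have ct0 : 0 < t - c by rewrite subr_gt0.
  (* Chosen so that [2 ^ -J < t - c]; the truncation to [J] digits then already exceeds [c]. *)
  pose J := (Num.truncn (t - c)^-1).+1.
  have hJ : (t - c)^-1 < 2 ^+ J.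
    apply: lt_trans (truncnS_gt _) _; rewrite -/J.
    by rewrite -natrX ltr_nat ltn_expl.
  have := h J; rewrite /dyadic_value dyadic_indexE// ler_pdivrMr ?exprn_gt0//.
  have : 2 ^+ J * t < (Num.truncn (2 ^+ J * t))%:R + 1 by rewrite natr1 truncnS_gt.
  move: (2 ^+ J) hJ => y hJ; rewrite -(ltr_pM2l ct0) mulfV ?gt_eqF// in hJ.
  by move: (Num.truncn _)%:R => x h1 h2; nra.
have [c1'|c1'] := ltP c 1.
  rewrite (_ : _ `&` _ = `[0, c]%classic); last first.
    apply/seteqP; split=> t /=; rewrite !in_itv/=; first by case=> -> /andP[->].
    by move=> /andP[-> tc]; rewrite tc (le_lt_trans tc).
  rewrite lebesgue_measure_itv/= lte_fin; case: ltP => h; first by rewrite oppr0 adde0.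
  by congr (_%:E); apply/eqP; rewrite eq_le c0 h.
have -> : c = 1 by apply/eqP; rewrite eq_le c1.
rewrite (_ : _ `&` _ = `[0, 1[%classic); last first.
  apply/seteqP; split=> t /=; rewrite !in_itv/=; first by case.
  by move=> /andP[-> tc]; rewrite tc ltW.
by rewrite lebesgue_measure_itv/= lte_fin ltr01 oppr0 adde0.
Qed.

Lemma below_le c c' e : c <= c' -> below c e -> below c' e.
Proof. by move=> cc h J; apply: le_trans cc. Qed.

Section with_law.
Context (d : measure_display) (Omega : measurableType d) (Q : probability Omega R).
Context (W : {RV Q >-> R}).

Definition rcdf (x : R) : R := fine (cdf W x).

Lemma rcdfE x : cdf W x = (rcdf x)%:E.
Proof. by rewrite fineK// fin_num_measure. Qed.

Lemma rcdf_itv x : 0 <= rcdf x <= 1.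
Proof. by rewrite -!lee_fin -rcdfE cdf_ge0 cdf_le1. Qed.

Lemma rcdf_nd x y : x <= y -> rcdf x <= rcdf y.
Proof. by move=> xy; rewrite -lee_fin -!rcdfE cdf_nondecreasing. Qed.

(** The first part makes the set whose infimum is the quantile nonempty, the second bounds it
    below. *)
Definition regular : set coins :=
  (\bigcup_n below (rcdf n%:R)) `&` ~` (\bigcap_n below (rcdf (- n%:R))).

Lemma measurable_regular : measurable regular.
Proof.
apply: measurableI.
  by apply: bigcup_measurable => n _; exact: measurable_below.
apply: measurableC; apply: bigcap_measurable => // n _; exact: measurable_below.
Qed.

(** The two exceptional events lie in events of probability [1 - rcdf n] and [rcdf (- n)], and the
    distribution function has limits 1 and 0 at the two ends. *)
Lemma coin_prob_irregular : P (~` regular) = 0%E.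
Proof.
have mU : measurable (\bigcup_n below (rcdf n%:R)).
  by apply: bigcup_measurable => n _; exact: measurable_below.
have mI : measurable (\bigcap_n below (rcdf (- n%:R))).
  by apply: bigcap_measurable => // n _; exact: measurable_below.
apply/eqP; rewrite eq_le measure_ge0 andbT.
have -> : ~` regular = ~` (\bigcup_n below (rcdf n%:R)) `|`
    \bigcap_n below (rcdf (- n%:R)) by rewrite /regular setCI setCK.
have E1 : P (~` (\bigcup_n below (rcdf n%:R))) = 0%E.
  apply/eqP; rewrite eq_le measure_ge0 andbT; apply/lee_addgt0Pr => eps eps0.
  have : cdf W x @[x --> +oo%R] --> 1%E by exact: cvg_cdfy1.
  move=> /fine_cvgP[_ /cvgrPdist_le/(_ _ eps0)[M [_ hM]]].
  pose n := (Num.truncn M).+1; have := hM n%:R (truncnS_gt _) => /= hn.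
  rewrite add0e; apply: (@le_trans _ _ (P (~` below (rcdf n%:R)))).
    apply: le_measure; rewrite ?inE; [exact: measurableC| |].
      by apply: measurableC; exact: measurable_below.
    by apply: subsetC => e he; exists n.
  rewrite probability_setC; last exact: measurable_below.
  rewrite coin_prob_below ?rcdf_itv// -EFinB lee_fin.
  by apply: le_trans hn; exact: ler_norm.
have E2 : P (\bigcap_n below (rcdf (- n%:R))) = 0%E.
  apply/eqP; rewrite eq_le measure_ge0 andbT; apply/lee_addgt0Pr => eps eps0.
  have : cdf W x @[x --> -oo%R] --> 0%E by exact: cvg_cdfNy0.
  move=> /fine_cvgP[_ /cvgrPdist_le/(_ _ eps0)[M [_ hM]]].
  pose n := (Num.truncn (- M)).+1.
  have nM : - n%:R < M by rewrite ltrNl truncnS_gt.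
  have := hM _ nM => /= hn.
  rewrite add0e; apply: (@le_trans _ _ (P (below (rcdf (- n%:R))))).
    apply: le_measure; rewrite ?inE; [by []|exact: measurable_below|].
    by move=> e /(_ n I).
  rewrite coin_prob_below ?rcdf_itv// lee_fin.
  by apply: le_trans hn; rewrite sub0r normrN; exact: ler_norm.
suff -> : P (~` (\bigcup_n below (rcdf n%:R)) `|`
    \bigcap_n below (rcdf (- n%:R))) = P (~` (\bigcup_n below (rcdf n%:R))).
  by rewrite E1.
by apply: measureU0 => //; exact: measurableC.
Qed.

(** The generalized inverse of the distribution function at the number coded by [e]; the value 0 on
    the null set of irregular points is arbitrary. *)
Definition quantile (e : coins) : R :=
  if e \in regular then inf [set x | below (rcdf x) e] else 0.

(** The Galois connection between quantile and distribution function; right continuity of the latter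
    gives the forward direction, since it makes the infimum attained. *)
Lemma quantile_le e x : regular e -> quantile e <= x <-> below (rcdf x) e.
Proof.
move=> re; rewrite /quantile mem_set//.
have [[n _ hn] /existsNP[m /not_implyP[_ hm]]] := re.
have lb : lbound [set x | below (rcdf x) e] (- m%:R).
  move=> y /= hy; rewrite leNgt; apply/negP => ym; apply: hm.
  by apply: below_le hy; apply: rcdf_nd; exact: ltW.
have hi : has_inf [set x | below (rcdf x) e] by split; [exists n%:R|exists (- m%:R)].
split; last by move=> h; apply: ge_inf => //; case: hi.
move=> hx J; apply/ler_addgt0Pr => eps eps0.
have : cdf W y @[y --> x^'+] --> cdf W x by exact: cdf_right_continuous.
rewrite rcdfE => /fine_cvgP[_ /cvgrPdist_le/(_ _ eps0) h].
have {}h : \forall y \near x^'+, rcdf y <= rcdf x + eps.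
  near=> y; have : `|rcdf x - rcdf y| <= eps by near: y.
  by rewrite ler_norml => /andP[h1 _]; lra.
have [y [xy hy]] : exists y, x < y /\ rcdf y <= rcdf x + eps.
  near (x^'+) => y; exists y; split; [by near: y; exact: nbhs_right_gt|by near: y].
have [z hz zy] : exists2 z, below (rcdf z) e & z < y.
  have xy0 : 0 < y - x by rewrite subr_gt0.
  have [z /= hz hlt] := inf_adherent xy0 hi.
  by exists z => //; apply: lt_le_trans hlt _; rewrite -lerBrDr; lra.
by apply: le_trans hy; apply: le_trans (hz J) _; apply: rcdf_nd; exact: ltW.
Unshelve. all: by end_near. Qed.

Lemma quantile_gt e x : regular e -> x < quantile e <-> ~ below (rcdf x) e.
Proof. by move=> re; rewrite ltNge -(quantile_le _ x re); split => /negP. Qed.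

Lemma measurable_quantile : measurable_fun setT quantile.
Proof.
apply: (measurability _ (RGenOInfty.measurableE R)) => _ [_ [x ->] <-].
rewrite setTI (_ : quantile @^-1` _ = (regular `&` ~` below (rcdf x)) `|`
    (~` regular `&` [set e | x < 0])); last first.
  apply/seteqP; split=> e /=; rewrite in_itv/= andbT.
    have [re|re] := pselect (regular e); first by rewrite quantile_gt//; left.
    by rewrite /quantile memNset//; right.
  move=> [[re]|[re]]; first by rewrite quantile_gt.
  by rewrite /quantile memNset.
apply: measurableU.
  by apply: measurableI; [exact: measurable_regular|apply: measurableC; exact: measurable_below].
apply: measurableI; first by apply: measurableC; exact: measurable_regular.
have [h|h] := ltP x 0; first by rewrite (_ : [set _ | _] = setT)//; apply/seteqP; split=> e /=.
by rewrite (_ : [set _ | _] = set0)//; apply/seteqP; split=> e /=.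
Qed.

(** It suffices to compare open right half-lines. Off a null set the quantile exceeds [x] exactly on
    the complement of [below (rcdf x)], whose mass is [1 - rcdf x]. *)
Lemma quantile_law A : measurable A -> P (quantile @^-1` A) = Q (W @^-1` A).
Proof.
move=> mA; have mq := measurable_quantile.
have := @measure_unique _ R R (@RGenOInfty.G R)
  (fun k => `]- k%:R, +oo[%classic) (RGenOInfty.measurableE R) _ _ _
  (pushforward P quantile) (distribution Q W) _ _ A mA; apply => //.
- move=> _ _ [x ->] [y ->]; exists (Num.max x y).
  apply/seteqP; split=> z /=; rewrite !in_itv/= !andbT gt_max; first by case=> -> ->.
  by move=> /andP[].
- by move=> k; exists (- k%:R).
- apply/seteqP; split=> // z _; exists (Num.truncn (- z)).+1 => //=.
  by rewrite in_itv/= andbT ltrNl truncnS_gt.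
- move=> _ [x ->].
  rewrite -[LHS]/(P (quantile @^-1` `]x, +oo[)) -[RHS]/(Q (W @^-1` `]x, +oo[)).
  have -> : P (quantile @^-1` `]x, +oo[) = P (~` below (rcdf x)); last first.
    rewrite probability_setC; last exact: measurable_below.
    have -> : W @^-1` `]x, +oo[ = ~` (W @^-1` `]-oo, x]).
      by rewrite preimage_setC setCitvl.
    rewrite probability_setC; last exact: measurable_funPTI.
    rewrite coin_prob_below ?rcdf_itv//; congr (_ - _)%E.
    by rewrite -rcdfE.
  apply: (@eq_measure_off _ _ _ P (~` regular)).
  + by apply: measurableC; exact: measurable_regular.
  + by rewrite -[X in measurable X]setTI; exact: mq.
  + by apply: measurableC; exact: measurable_below.
  + exact: coin_prob_irregular.
  + by move=> e /contrapT re; rewrite /= in_itv/= andbT quantile_gt.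
- move=> k; rewrite -[X in (X < _)%E]/(P (quantile @^-1` `]- k%:R, +oo[)).
  rewrite -ge0_fin_numE// fin_num_measure// -[X in measurable X]setTI; exact: mq.
Qed.

End with_law.
End quantile.

(** * Convergence to the Dirac mass *)

(** A bounded continuous [f] satisfies [|f y - f 0| <= eps / 2 + c |y|] for a suitable [c], so
    smallness of the mean of [|S n|] passes to [f]. *)
Lemma converges_in_law_dirac0 (d : measure_display) (T : measurableType d)
    (R : realType) (P : probability T R) (S : nat -> T -> R) :
  (forall n, measurable_fun setT (S n)) ->
  (forall eps : R, 0 < eps ->
     \forall n \near \oo, (\int[P]_w `|S n w|%:E <= eps%:E)%E) ->
  converges_in_law P S (\d_(0 : R) : probability R R).
Proof.
move=> mS S0 f cf [M fM].
have mf : measurable_fun setT f by exact: continuous_measurable_fun.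
have mfS n : measurable_fun setT (fun w => f (S n w)) by exact: measurableT_comp.
have ifS n : P.-integrable setT (fun w => (f (S n w))%:E).
  apply: measurable_bounded_integrable => //.
    by rewrite (le_lt_trans (probability_le1 _ _)) ?ltry.
  exists M; split=> [|r Mr w _]; first exact: num_real.
  exact: le_trans (ltW Mr).
rewrite integral_dirac//; last exact/measurable_EFinP.
rewrite diracT mul1e.
apply/fine_cvgP; split; first by apply: nearW => n; exact: integrable_fin_num.
apply/cvgrPdist_le => eps eps0.
have eps20 : 0 < eps / 2 by rewrite divr_gt0.
have [del del0 hdel] : exists2 del : R, 0 < del &
    forall y, `|y| < del -> `|f y - f 0| <= eps / 2.
  have /cvgrPdist_le/(_ _ eps20) := cf 0.
  move=> /nbhs_ballP[del /= del0 h]; exists del => // y yd.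
  by rewrite distrC; apply: h; rewrite /ball/= sub0r normrN.
have M0 : 0 <= M by exact: le_trans (fM 0).
(* For [|y| >= del] the difference [|f y - f 0|] is at most [2 M], and there [c |y| >= 2 M]. *)
pose c := 2 * M / del; have c0 : 0 <= c by rewrite divr_ge0 ?mulr_ge0// ltW.
have fle y : `|f y - f 0| <= eps / 2 + c * `|y|.
  have [yd|yd] := ltP `|y| del.
    by apply: le_trans (hdel _ yd) _; rewrite lerDl mulr_ge0.
  apply: le_trans (ler_normB _ _) _.
  apply: (@le_trans _ _ (c * `|y|)); last by rewrite lerDr ltW.
  apply: (@le_trans _ _ (2 * M)); first by have := fM y; have := fM 0; lra.
  by rewrite /c mulrAC ler_pdivlMr// ler_wpM2l// mulr_ge0.
have c10 : 0 < c + 1 by rewrite ltr_wpDl.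
have e0 : 0 < eps / 2 / (c + 1) by rewrite divr_gt0.
near=> n.
have Sn : (\int[P]_w `|S n w|%:E <= (eps / 2 / (c + 1))%:E)%E by near: n; exact: S0.
rewrite distrC -lee_fin -[f 0]/(fine (f 0)%:E) -fineB//; last exact: integrable_fin_num.
have intB : P.-integrable setT (fun w => (f (S n w))%:E - (f 0)%:E)%E.
  by apply: integrableB => //; exact: finite_measure_integrable_cst.
have -> : (\int[P]_w (f (S n w))%:E - (f 0)%:E =
    \int[P]_w ((f (S n w))%:E - (f 0)%:E))%E.
  rewrite integralB//; last exact: finite_measure_integrable_cst.
  by rewrite integral_cst//= probability_setT mule1.
rewrite -[leLHS]/(`|(fine _)%:E|)%E fineK; last exact: integrable_fin_num.
apply: le_trans (le_abse_integral _ _ _) _ => //; first exact: measurable_int intB.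
apply: (@le_trans _ _ (\int[P]_w ((eps / 2)%:E + c%:E * `|S n w|%:E))%E).
  apply: ge0_le_integral => //.
  - by apply: measurableT_comp => //; exact: measurable_int intB.
  - apply: emeasurable_funD => //; apply: emeasurable_funM => //.
    by apply/measurable_EFinP/measurableT_comp.
  - by move=> w _; rewrite -EFinB -EFinM -EFinD abse_EFin lee_fin.
have mabs : measurable_fun setT (fun w => `|S n w|%:E).
  by apply/measurable_EFinP/measurableT_comp.
rewrite ge0_integralD//; last 3 first.
- by move=> w _; rewrite lee_fin ltW.
- by move=> w _; rewrite mule_ge0.
- exact: emeasurable_funM.
rewrite integral_cst//= probability_setT mule1 ge0_integralZl//.
apply: le_trans (leeD (lexx _) (lee_wpmul2l _ Sn)) _ => //.
rewrite -EFinM -EFinD lee_fin [leRHS]splitr lerD2l.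
by rewrite mulrCA ler_piMr ?(ltW eps20)// ler_pdivrMr// mul1r lerDl.
Unshelve. all: by end_near. Qed.

(** * The sequence and its limit law *)

Theorem theorem1p4 (R : realType) (d : measure_display) (Omega : measurableType d)
  (Q : probability Omega R) (W : {RV Q >-> R}) :
  (W : Omega -> R) \in Lfun Q 2%:E ->
  ~ (exists c : R, Q (W @^-1` [set c]) = 1%E) ->
  let mu := fine 'E_Q[W] in
  let sigma := Num.sqrt (fine 'V_Q[W]) in
  exists (d' : measure_display) (T : measurableType d') (P : probability T R)
         (X : nat -> {RV P >-> R}),
    triplewise_independent P (fun k => (X k : T -> R)) /\
    (forall k, same_law P (X k) Q W) /\
    exists nu : probability R R,
      converges_in_law P
        (fun n w => (\sum_(k < n) X k w - n%:R * mu) / (sigma * Num.sqrt n%:R)) nu /\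
      ~ is_normal nu.
Proof.
move=> W2 _ mu sigma.
pose h : coins -> R := quantile _ _ _ W.
have mh : measurable_fun setT h := measurable_quantile _ _ _ W.
have mX k : measurable_fun setT (h \o affine k).
  by apply: measurableT_comp => //; exact: measurable_affine.
have h2 : h \in Lfun (coin_prob R) 2%:E.
  apply: (@Lfun2_same_law _ _ _ coins Omega R R (coin_prob R) Q h W _ _ _ id) => //.
  exact: quantile_law.
have Eh : fine 'E_(coin_prob R)[h]%E = mu.
  rewrite /mu unlock; congr fine.
  apply: (@integral_same_law _ _ _ coins Omega R R (coin_prob R) Q h W _ _ _ EFin) => //.
  exact: quantile_law.
have mhpre B : measurable B -> measurable (h @^-1` B).
  by move=> mB; rewrite -[_ @^-1` _]setTI; exact: mh.
pose X k : {RV coin_prob R >-> R} :=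
  HB.pack (h \o affine k) (isMeasurableFun.Build _ _ coins R _ (mX k)).
exists _, coins, (coin_prob R), X; split; [|split].
- move=> idx idx_inj B mB.
  pose o0 : 'I_3 := ord0; pose o1 : 'I_3 := lift ord0 ord0.
  pose o2 : 'I_3 := lift ord0 (lift ord0 ord0).
  rewrite !big_ord_recl big_ord0 mule1.
  have -> : \bigcap_(j in [set: 'I_3]) (X (idx j) @^-1` B j) =
      affine (idx o0) @^-1` (h @^-1` B o0) `&`
      (affine (idx o1) @^-1` (h @^-1` B o1) `&` affine (idx o2) @^-1` (h @^-1` B o2)).
    apply/seteqP; split=> e /= H; first by split; [|split]; exact: H.
    case: H => H0 [H1 H2] [[|[|[|//]]] j3] _ /=.
    + by rewrite (_ : Ordinal j3 = o0)//; exact: val_inj.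
    + by rewrite (_ : Ordinal j3 = o1)//; exact: val_inj.
    + by rewrite (_ : Ordinal j3 = o2)//; exact: val_inj.
  rewrite affine_law3; [|by move/idx_inj|by move/idx_inj|by move/idx_inj|
    exact: mhpre|exact: mhpre|exact: mhpre].
  congr (_ * (_ * _))%E; apply/esym; apply: affine_law; exact: mhpre.
- move=> k A mA; rewrite -(quantile_law _ _ _ W A mA).
  by apply: affine_law; exact: mhpre.
(* A normal law gives mass 0 to the Lebesgue null set [{0}], to which the Dirac mass gives 1. *)
exists (\d_(0 : R) : probability R R); split; last first.
  move=> [m [s [s0 H]]].
  have : \d_(0 : R) [set 0] = normal_prob m s [set 0] := H _ (measurable_set1 0).
  rewrite diracE mem_set//=.
  have /null_content_dominatesP := normal_prob_dominates m s.
  move=> /(_ [set 0] (measurable_set1 _) (lebesgue_measure_set1 _)).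
  by move=> -> /eqP; rewrite onee_eq0.
apply: converges_in_law_dirac0 => [n|eps eps0].
  apply: measurable_funM => //; rewrite -Eh; exact: measurable_fluct.
have [_ vh] := vanishing_Lfun2 _ h2.
(* If [sigma] is 0, the standardized sum is 0 because the inverse of 0 is 0. *)
have [sig0|sig0] := leP sigma 0.
  have -> : sigma = 0 by apply/eqP; rewrite eq_le sig0 sqrtr_ge0.
  apply: nearW => n; under eq_integral do rewrite mul0r invr0 mulr0 normr0.
  by rewrite integral0 lee_fin ltW.
near=> n.
have n0 : 0 < Num.sqrt n%:R :> R.
  by rewrite sqrtr_gt0 ltr0n; near: n; exact: nbhs_infty_gt.
have c0 : 0 <= (sigma * Num.sqrt n%:R)^-1 by rewrite invr_ge0 mulr_ge0// ltW.
(* The tolerance [eps * sigma] becomes [eps] after division by [sigma * sqrt n]. *)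
have hn : (mean_fluct h n <= (eps * sigma * Num.sqrt n%:R)%:E)%E.
  by near: n; apply: vh; rewrite mulr_gt0.
have -> : (\int[coin_prob R]_w `|(\sum_(k < n) X k w - n%:R * mu) /
    (sigma * Num.sqrt n%:R)|%:E =
    ((sigma * Num.sqrt n%:R)^-1)%:E * mean_fluct h n)%E.
  rewrite /mean_fluct -ge0_integralZl//; last first.
    by apply/measurable_EFinP/measurableT_comp => //; exact: measurable_fluct.
  apply: eq_integral => w _; rewrite -EFinM -Eh; congr (_%:E).
  by rewrite normrM mulrC (ger0_norm c0).
apply: le_trans (lee_wpmul2l _ hn) _ => //.
rewrite -EFinM lee_fin mulrC -[eps * sigma * _]mulrA mulfK//.
by rewrite gt_eqF// mulr_gt0.
Unshelve. all: by end_near. Qed.
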